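(* Let $k\ge 2$, $a\in\{1,\dots,k-1\}$, $m$ a positive integer, and $\lambda:=m\omega_a$. Let $F^\lambda=\{F^\lambda_b\}_{b\in B^\lambda}$ be the upper global basis of the irreducible $U_q(\mathfrak{sl}_k)$-representation $V^\lambda$ and, for $0\le j\le m$, let $\widehat F^{\lambda^j}=\{\widehat F^j_b\}_{b\in\widehat B^{\lambda^j}}$ be the upper global basis of the irreducible $U_q(\mathfrak{sl}_{k-1})$-representation $\widehat V^{\lambda^j}$ with highest weight $\lambda^j=j\omega_{a-1}+(m-j)\omega_a$. With $v_j$ and $\phi_j$ as defined in the context and $(\cdot,\cdot)$ the Shapovalov form on $V^\lambda$, $$F^{\lambda}=\bigsqcup_{j=0}^m\frac{\phi_j(\widehat F^{\lambda^j})}{(v_j,v_j)}.$$ In particular, $\dfrac{\phi_j(\widehat F^j_b)}{(v_j,v_j)}=F^\lambda_{\phi_j(b)}$ for all $0\le j\le m$ and $b\in\widehat B^{\lambda^j}$.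
   Context: Quantum group. The weight lattice $P$ of $\mathfrak{sl}_k$ is the $\mathbb Z$-module generated by $E_1,\dots,E_k$ subject to $E_1+\cdots+E_k=0$; $\alpha_i=E_i-E_{i+1}$ are the simple roots, $h_1,\dots,h_{k-1}$ the simple coroots (a basis of the coroot lattice $P^\vee$), $\omega_i=E_1+\cdots+E_i$ the fundamental weights, $\omega_i(h_j)=\delta_{ij}$. Dominant weights are nonnegative integer combinations of the $\omega_i$. $U_q(\mathfrak{sl}_k)$ is the unital associative $\mathbb Q(q)$-algebra generated by $e_i,f_i$ ($1\le i\le k-1$), $q^h$ ($h\in P^\vee$) with relations $q^0=1$, $q^hq^{h'}=q^{h+h'}$; $q^he_iq^{-h}=q^{\alpha_i(h)}e_i$, $q^hf_iq^{-h}=q^{-\alpha_i(h)}f_i$; $e_if_j-f_je_i=\delta_{ij}\frac{q^{h_i}-q^{-h_i}}{q-q^{-1}}$; for $|i-j|=1$, $e_i^2e_j-(q+q^{-1})e_ie_je_i+e_je_i^2=0$ and likewise for the $f$'s; for $|i-j|>1$, $e_ie_j=e_je_i$, $f_if_j=f_jf_i$. Put $[x;n]_q=\frac{xq^n-x^{-1}q^{-n}}{q-q^{-1}}$, $[n]_q=[1;n]_q$, $[n]_q!=[n]_q\cdots[1]_q$, $[0]_q!=1$, $e_i^{(n)}=e_i^n/[n]_q!$, $f_i^{(n)}=f_i^n/[n]_q!$. Representations are finite-dimensional over $\mathbb Q(q)$ with $V=\bigoplus_{\mu\in P}V_\mu$, $V_\mu=\{v:q^hv=q^{\mu(h)}v\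 \forall h\in P^\vee\}$. For $\lambda$ dominant, $V^\lambda$ is the irreducible representation with highest weight $\lambda$, and $v_\lambda\in V^\lambda_\lambda$ is a fixed nonzero vector. Crystal basis. Each $u\in V_\mu$ is uniquely $u=\sum_{n=0}^Nf_i^{(n)}u_n$ with $u_n\in V_{\mu+n\alpha_i}\cap\ker e_i$ ($u_n=0$ whenever $f_i^{(n)}u_n=0$); put $\tilde e_iu=\sum_{n\ge1}f_i^{(n-1)}u_n$, $\tilde f_iu=\sum_{n\ge0}f_i^{(n+1)}u_n$, extended linearly. Let $A_0$ be the localization of $\mathbb Q[q]$ at $(q)$. A crystal lattice is a free $A_0$-submodule $L\subset V$ with $\mathbb Q(q)\otimes_{A_0}L\cong V$, $L=\bigoplus_\mu L_\mu$ ($L_\mu=L\cap V_\mu$), $\tilde e_iL\subset L$, $\tilde f_iL\subset L$. A crystal basis is a pair $(L,B)$ with $L$ a crystal lattice and $B$ a $\mathbb Q$-basis of $L/qL$ such that $B=\bigsqcup_\mu B_\mu$ with $B_\mu=B\cap L_\mu/qL_\mu$, $\tilde e_iB,\tilde f_iB\subset B\cup\{0\}$, and $\tilde f_ib=b'\iff\tilde e_ib'=b$ for $b,b'\in B$. For $v\in L$, $\overline v$ is its image in $L/qL$. $(L^\lambda,B^\lambda)$ is the unique crystal basis of $V^\lambda$ with $L^\lambda_\lambda=A_0v_\lambda$ and $B^\lambda_\lambda=\{\overline{v_\lambda}\}$. Global bases. Let $A=\mathbb Q[q,q^{-1}]$ and let $U_A(\mathfrak{sl}_k)$ be the $A$-subalgebra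 of $U_q(\mathfrak{sl}_k)$ generated by $e_i^{(n)},f_i^{(n)},q^h,\frac{[q^h;0]_q\cdots[q^h;1-n]_q}{[n]_q!}$ ($n\ge1$). Let $\psi$ be the $\mathbb Q$-algebra automorphism of $U_q(\mathfrak{sl}_k)$ with $e_i\mapsto e_i$, $f_i\mapsto f_i$, $q\mapsto q^{-1}$, $q^h\mapsto q^{-h}$, and also the induced $\mathbb Q$-linear map $pv_\lambda\mapsto\psi(p)v_\lambda$ of $V^\lambda$. The lower global basis $G^\lambda=\{G^\lambda_b\}_{b\in B^\lambda}$ is the unique $A_0$-basis of $L^\lambda$ that is a $\mathbb Q$-basis of $U_A(\mathfrak{sl}_k)v_\lambda\cap L^\lambda\cap\psi(L^\lambda)$ and satisfies $\overline{G^\lambda_b}=b$, $\psi(G^\lambda_b)=G^\lambda_b$ for all $b$. Let $\varphi$ be the antiautomorphism of $U_q(\mathfrak{sl}_k)$ with $e_i\mapsto f_i$, $f_i\mapsto e_i$, $q\mapsto q$, $q^h\mapsto q^h$. The Shapovalov form on $V^\lambda$ is the unique symmetric bilinear form $(\cdot,\cdot)$ with $(v_\lambda,v_\lambda)=1$ and $(pu,v)=(u,\varphi(p)v)$ for $u,v\in V^\lambda$, $p\in U_q(\mathfrak{sl}_k)$. The upper global basis $F^\lambda=\{F^\lambda_b\}_{b\in B^\lambda}$ is the basis dual to $G^\lambda$ with respect to this form: $(F^\lambda_b,G^\lambda_{b'})=\delta_{b,b'}$. Restriction. $U_q(\mathfrak{sl}_{k-1})\subset U_q(\mathfrak{sl}_k)$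 is the subalgebra generated by $e_i,f_i$ ($1\le i\le k-2$) and $q^h$, $h\in\mathbb Zh_1+\cdots+\mathbb Zh_{k-2}$ (it is $\mathbb Q(q)$ if $k=2$). Hats denote the same objects for $\mathfrak{sl}_{k-1}$. For $0\le j\le m$: $v_j:=f_{k-1}^{(j)}f_{k-2}^{(j)}\cdots f_a^{(j)}v_\lambda\in V^\lambda$; $\lambda^j:=j\omega_{a-1}+(m-j)\omega_a$ as a weight of $\mathfrak{sl}_{k-1}$, where $\omega_0=0$ and $\omega_{k-1}=0$ in the weight lattice of $\mathfrak{sl}_{k-1}$; $u_j\in\widehat V^{\lambda^j}_{\lambda^j}$ is a fixed nonzero vector, used as the highest weight vector in the normalization of the crystal basis $(\widehat L^{\lambda^j},\widehat B^{\lambda^j})$ (so $\widehat L^{\lambda^j}_{\lambda^j}=A_0u_j$, $\widehat B^{\lambda^j}_{\lambda^j}=\{\overline{u_j}\}$), of the global bases, and of the Shapovalov form of $\widehat V^{\lambda^j}$; $\phi_j:\widehat V^{\lambda^j}\to U_q(\mathfrak{sl}_{k-1})v_j$ is the isomorphism of $U_q(\mathfrak{sl}_{k-1})$-representations with $\phi_j(u_j)=v_j$. It is known that $\phi_j(\widehat L^{\lambda^j})\subset L^\lambda$ and that the induced map $\widehat L^{\lambda^j}/q\widehat L^{\lambda^j}\to L^\lambda/qL^\lambda$, also denoted $\phi_j$, sends $\widehat B^{\lambda^j}$ into $B^\lambda$. *)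

(* Defs.v *)
From HB Require Import structures.
From mathcomp Require Import all_boot all_order all_algebra.
From mathcomp Require Import generic_quotient fraction.
From mathcomp Require Import boolp classical_sets.

Set Implicit Arguments.
Unset Strict Implicit.
Unset Printing Implicit Defensive.

Import GRing.Theory.
Local Open Scope ring_scope.
Local Open Scope quotient_scope.

Definition Qq : fieldType := {fraction {poly rat}}.
Definition of_poly : {poly rat} -> Qq := @tofrac _.
Definition of_rat (c : rat) : Qq := of_poly c%:P.
Definition q : Qq := of_poly 'X.

HB.instance Definition _ := GRing.RMorphism.on of_poly.
Fact of_rat_monoid_morphism : monoid_morphism of_rat.
Proof. by split=> [|x y]; rewrite /of_rat ?polyCM ?rmorphM ?polyC1 ?rmorph1. Qed.
Fact of_rat_zmod_morphism : zmod_morphism of_rat.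
Proof. by move=> x y; rewrite /of_rat polyCB rmorphB. Qed.
HB.instance Definition _ := GRing.isZmodMorphism.Build rat Qq of_rat of_rat_zmod_morphism.
HB.instance Definition _ := GRing.isMonoidMorphism.Build rat Qq of_rat of_rat_monoid_morphism.

(* The subrings Q, A_0 = Q[q]_(q) and A = Q[q, q^-1] of Q(q). *)
Definition Qsub : set Qq := [set x | exists c : rat, x = of_rat c].
Definition A0 : set Qq :=
  [set x | exists p d : {poly rat}, d.[0] != 0 /\ x = of_poly p / of_poly d].
Definition Alaur : set Qq :=
  [set x | exists (p : {poly rat}) (n : nat), x = of_poly p / q ^+ n].

(* [x; n]_q, where xV stands for the inverse of x. *)
Definition qbracket (R : lmodType Qq) (x xV : R) (n : int) : R :=
  (q - q^-1)^-1 *: (q ^ n *: x - q ^ (- n) *: xV).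
Definition qint (n : nat) : Qq := qbracket (1 : Qq^o) (1 : Qq^o) n.
Definition qfact (n : nat) : Qq := \prod_(1 <= t < n.+1) qint t.

(* The field automorphism q |-> q^-1 of Q(q). *)
Definition eval_qV (p : {poly rat}) : Qq := (map_poly of_rat p).[q^-1].
Definition barQ (x : Qq) : Qq :=
  eval_qV (frac (repr x)).1 / eval_qV (frac (repr x)).2.

Lemma q_neq0 : q != 0.
Proof. by rewrite /q /of_poly tofrac_eq0 polyX_eq0. Qed.

Fact eval_qV_zmod_morphism : zmod_morphism eval_qV.
Proof. by move=> x y; rewrite /eval_qV rmorphB hornerD hornerN. Qed.
Fact eval_qV_monoid_morphism : monoid_morphism eval_qV.
Proof. by split=> [|x y]; rewrite /eval_qV ?rmorph1 ?hornerC ?rmorphM ?hornerM. Qed.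
HB.instance Definition _ :=
  GRing.isZmodMorphism.Build {poly rat} Qq eval_qV eval_qV_zmod_morphism.
HB.instance Definition _ :=
  GRing.isMonoidMorphism.Build {poly rat} Qq eval_qV eval_qV_monoid_morphism.

Lemma eval_qV_eq0 p : (eval_qV p == 0) = (p == 0).
Proof.
apply/idP/idP => [|/eqP->]; last by rewrite rmorph0.
move/eqP => p0; apply/eqP.
pose n := size p.
have : of_poly (\sum_(i < n) p`_i *: 'X^(n - i)) = 0.
  transitivity (eval_qV p * q ^+ n); last by rewrite p0 mul0r.
  rewrite /eval_qV horner_coef size_map_inj_poly ?rmorph0 //; last first.
    exact: fmorph_inj.
  rewrite mulr_suml rmorph_sum; apply: eq_bigr => i _ /=.
  rewrite coef_map /= -mul_polyC rmorphM rmorphXn /= -mulrA; congr (_ * _).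
  rewrite -[in RHS](subnK (ltnW (ltn_ord i))) addnC exprD mulrA exprVn.
  by rewrite mulVf ?mul1r ?expf_neq0 ?q_neq0.
move/eqP; rewrite /of_poly tofrac_eq0 => /eqP s0.
apply/polyP => i; rewrite coef0.
have [le_n_i|lt_i_n] := leqP n i; first by rewrite nth_default.
have := congr1 (fun r : {poly rat} => r`_(n - i)) s0.
rewrite coef0 coef_sum (bigD1 (Ordinal lt_i_n)) //= coefZ coefXn eqxx mulr1.
rewrite big1 ?addr0 // => j /eqP neq_ji; rewrite coefZ coefXn.
case: eqP => [e|]; last by rewrite mulr0.
case: neq_ji; apply: val_inj => /=.
by apply/eqP; rewrite -(eqn_sub2lE (ltnW (ltn_ord j)) (ltnW lt_i_n)) e.
Qed.

Lemma Qq_numden (x : Qq) :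
  x = of_poly (frac (repr x)).1 / of_poly (frac (repr x)).2.
Proof.
rewrite -{1}(reprK x); move: (repr x) => r; rewrite /of_poly !piE.
apply/eqmodP; rewrite /= FracField.equivfE /FracField.invf /FracField.mulf.
have d0 := denom_ratioP r.
by rewrite !numden_Ratio ?oner_eq0 ?mulr1 ?mul1r // mulrC.
Qed.

Lemma of_poly_eq (p r : {poly rat}) : of_poly p = of_poly r -> p = r.
Proof. by move/eqP; rewrite tofrac_eq => /eqP. Qed.
Lemma of_poly_eq0 (p : {poly rat}) : (of_poly p == 0) = (p == 0).
Proof. exact: tofrac_eq0. Qed.

Lemma barQ_div (p d : {poly rat}) :
  d != 0 -> barQ (of_poly p / of_poly d) = eval_qV p / eval_qV d.
Proof.
move=> d0; rewrite /barQ; set x := (X in repr X).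
move: (Qq_numden x) (denom_ratioP (repr x)).
move: (frac (repr x)).1 (frac (repr x)).2 => n e; rewrite /x => {x} xE e0.
have pe_nd : p * e = n * d.
  apply: of_poly_eq; rewrite !(rmorphM of_poly).
  by apply/eqP; rewrite -eqr_div ?of_poly_eq0 //; apply/eqP.
apply/eqP; rewrite eqr_div ?eval_qV_eq0 //.
by rewrite -!(rmorphM eval_qV) pe_nd.
Qed.

Lemma barQ_poly p : barQ (of_poly p) = eval_qV p.
Proof.
have := @barQ_div p 1 (oner_neq0 _).
by rewrite (rmorph1 of_poly) (rmorph1 eval_qV) !divr1.
Qed.

Fact barQ_zmod_morphism : zmod_morphism barQ.
Proof.
move=> x y; rewrite (Qq_numden x) (Qq_numden y).
move: (denom_ratioP (repr x)) (denom_ratioP (repr y)).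
move: (frac (repr x)) (frac (repr y)) => [n d] [n' d'] /= d0 d'0.
rewrite !barQ_div // -!mulNr -(rmorphN of_poly) -(rmorphN eval_qV).
rewrite !addf_div ?of_poly_eq0 ?eval_qV_eq0 //.
rewrite -!(rmorphM of_poly) -(rmorphD of_poly) barQ_div ?mulf_neq0 //.
by rewrite (rmorphD eval_qV) !(rmorphM eval_qV).
Qed.
Fact barQ_monoid_morphism : monoid_morphism barQ.
Proof.
split=> [|x y].
  by rewrite -(rmorph1 of_poly) barQ_poly (rmorph1 of_poly) (rmorph1 eval_qV).
rewrite (Qq_numden x) (Qq_numden y).
move: (denom_ratioP (repr x)) (denom_ratioP (repr y)).
move: (frac (repr x)) (frac (repr y)) => [n d] [n' d'] /= d0 d'0.
rewrite !barQ_div // !mulf_div -!(rmorphM of_poly) barQ_div ?mulf_neq0 //.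
by rewrite !(rmorphM eval_qV).
Qed.
HB.instance Definition _ := GRing.isZmodMorphism.Build Qq Qq barQ barQ_zmod_morphism.
HB.instance Definition _ := GRing.isMonoidMorphism.Build Qq Qq barQ barQ_monoid_morphism.

Lemma barQ_q : barQ q = q^-1.
Proof. by rewrite /q barQ_poly /eval_qV map_polyX hornerX. Qed.

(* Weights and coroots of sl_k. Nodes of the Dynkin diagram are i : 'I_k.-1,  *)
(* standing for the 1-based index i.+1; E and omega take 1-based nat indices. *)

(* P^vee, with basis h_i, and P, identified with the Z-dual of P^vee: mu is   *)
(* the row of its values mu(h_j).                                             *)
Definition coweight (k : nat) := 'rV[int]_k.-1.
Definition weight (k : nat) := 'rV[int]_k.-1.

Definition coroot k (i : 'I_k.-1) : coweight k := delta_mx 0 i.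
Definition pair k (mu : weight k) (h : coweight k) : int :=
  \sum_(j < k.-1) mu 0 j * h 0 j.

(* E_i(h_j) = delta_(i,j) - delta_(i,j+1). *)
Definition E k (i : nat) : weight k :=
  \row_(j < k.-1) ((i == j.+1)%:R - (i == j.+2)%:R).
Definition alpha k (i : 'I_k.-1) : weight k := E k i.+1 - E k i.+2.
Definition omega k (i : nat) : weight k := \sum_(1 <= l < i.+1) E k l.

Lemma omegaE k (i : nat) (j : 'I_k.-1) : omega k i 0 j = (i == j.+1)%:R.
Proof.
rewrite /omega; elim: i => [|i IHi]; first by rewrite big_geq // mxE.
rewrite big_nat_recr //= mxE IHi mxE eqSS.
by rewrite [(i == j.+1)%:R + _]addrC subrK.
Qed.

Lemma omega_coroot k (i : nat) (j : 'I_k.-1) :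
  pair (omega k i) (coroot j) = (i == j.+1)%:R.
Proof.
rewrite /pair (bigD1 j) //= omegaE !mxE !eqxx mulr1 big1 ?addr0 // => l ne_lj.
by rewrite mxE eqxx (negPf ne_lj) mulr0.
Qed.

Lemma omega_last k : omega k k = 0.
Proof.
apply/rowP => j; rewrite omegaE mxE; case: eqP => // e.
by have := ltn_ord j; rewrite {2}e ltnn.
Qed.

Lemma sum_E k : \sum_(1 <= i < k.+1) E k i = 0.
Proof. exact: omega_last. Qed.

Lemma pairDr k (mu : weight k) (h h' : coweight k) :
  pair mu (h + h') = pair mu h + pair mu h'.
Proof. by rewrite -big_split; apply: eq_bigr => j _; rewrite mxE mulrDr. Qed.

(* U_q(sl_k) by generators and relations: formal expressions modulo the least *)
(* Q(q)-algebra congruence containing the defining relations.                 *)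

Inductive expr (k : nat) : Type :=
| xscal of Qq
| xe of 'I_k.-1
| xf of 'I_k.-1
| xK of coweight k
| xadd of expr k & expr k
| xmul of expr k & expr k.
Arguments xscal {k}.

Section Congruence.
Variable k : nat.
Local Notation "x +! y" := (xadd x y) (at level 50, left associativity).
Local Notation "x *! y" := (xmul x y) (at level 40, left associativity).
Local Notation "c %:x" := (@xscal k c) (at level 2, format "c %:x").

Inductive ueq : expr k -> expr k -> Prop :=
| ueq_refl x : ueq x x
| ueq_sym x y : ueq x y -> ueq y x
| ueq_trans x y z : ueq x y -> ueq y z -> ueq x z
| ueq_add x x' y y' : ueq x x' -> ueq y y' -> ueq (x +! y) (x' +! y')
| ueq_mul x x' y y' : ueq x x' -> ueq y y' -> ueq (x *! y) (x' *! y')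
| ueq_addA x y z : ueq (x +! (y +! z)) (x +! y +! z)
| ueq_addC x y : ueq (x +! y) (y +! x)
| ueq_add0 x : ueq (0%:x +! x) x
| ueq_addN x : ueq ((-1)%:x *! x +! x) 0%:x
| ueq_mulA x y z : ueq (x *! (y *! z)) (x *! y *! z)
| ueq_mul1l x : ueq (1%:x *! x) x
| ueq_mulDl x y z : ueq ((x +! y) *! z) (x *! z +! y *! z)
| ueq_mulDr x y z : ueq (x *! (y +! z)) (x *! y +! x *! z)
| ueq_scalD c d : ueq (c + d)%:x (c%:x +! d%:x)
| ueq_scalM c d : ueq (c * d)%:x (c%:x *! d%:x)
| ueq_scalC c x : ueq (c%:x *! x) (x *! c%:x)
| ueq_K0 : ueq (xK 0) 1%:x
| ueq_KD h h' : ueq (xK h *! xK h') (xK (h + h'))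
| ueq_Ke h i :
    ueq (xK h *! xe i *! xK (- h)) ((q ^ pair (alpha i) h)%:x *! xe i)
| ueq_Kf h i :
    ueq (xK h *! xf i *! xK (- h)) ((q ^ (- pair (alpha i) h))%:x *! xf i)
| ueq_ef i j :
    ueq (xe i *! xf j +! (-1)%:x *! (xf j *! xe i))
        ((if i == j then (q - q^-1)^-1 else 0)%:x
           *! (xK (coroot i) +! (-1)%:x *! xK (- coroot i)))
| ueq_serre_e (i j : 'I_k.-1) : (i.+1 == j)%N || (j.+1 == i)%N ->
    ueq (xe i *! xe i *! xe j +! (- (q + q^-1))%:x *! (xe i *! xe j *! xe i)
           +! xe j *! xe i *! xe i) 0%:x
| ueq_serre_f (i j : 'I_k.-1) : (i.+1 == j)%N || (j.+1 == i)%N ->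
    ueq (xf i *! xf i *! xf j +! (- (q + q^-1))%:x *! (xf i *! xf j *! xf i)
           +! xf j *! xf i *! xf i) 0%:x
| ueq_comm_e (i j : 'I_k.-1) : (i.+1 < j)%N || (j.+1 < i)%N ->
    ueq (xe i *! xe j) (xe j *! xe i)
| ueq_comm_f (i j : 'I_k.-1) : (i.+1 < j)%N || (j.+1 < i)%N ->
    ueq (xf i *! xf j) (xf j *! xf i).

End Congruence.

(* Evaluation of expressions in a ring with a central copy of Q(q) (through a *)
(* possibly semilinear sc) and elements satisfying the defining relations.    *)
Record uq_model (k : nat) (A : pzRingType) := UqModel {
  m_sc : {rmorphism Qq -> A};
  m_e : 'I_k.-1 -> A;
  m_f : 'I_k.-1 -> A;
  m_K : coweight k -> A;
  m_scC : forall c x, m_sc c * x = x * m_sc c;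
  m_K0 : m_K 0 = 1;
  m_KD : forall h h', m_K h * m_K h' = m_K (h + h');
  m_Ke : forall h i, m_K h * m_e i * m_K (- h) = m_sc (q ^ pair (alpha i) h) * m_e i;
  m_Kf : forall h i, m_K h * m_f i * m_K (- h) = m_sc (q ^ (- pair (alpha i) h)) * m_f i;
  m_ef : forall i j, m_e i * m_f j - m_f j * m_e i =
    m_sc (if i == j then (q - q^-1)^-1 else 0) * (m_K (coroot i) - m_K (- coroot i));
  m_serre_e : forall i j : 'I_k.-1, (i.+1 == j)%N || (j.+1 == i)%N ->
    m_e i * m_e i * m_e j - m_sc (q + q^-1) * (m_e i * m_e j * m_e i)
      + m_e j * m_e i * m_e i = 0;
  m_serre_f : forall i j : 'I_k.-1, (i.+1 == j)%N || (j.+1 == i)%N ->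
    m_f i * m_f i * m_f j - m_sc (q + q^-1) * (m_f i * m_f j * m_f i)
      + m_f j * m_f i * m_f i = 0;
  m_comm_e : forall i j : 'I_k.-1, (i.+1 < j)%N || (j.+1 < i)%N ->
    m_e i * m_e j = m_e j * m_e i;
  m_comm_f : forall i j : 'I_k.-1, (i.+1 < j)%N || (j.+1 < i)%N ->
    m_f i * m_f j = m_f j * m_f i
}.

Section Eval.
Variables (k : nat) (A : pzRingType) (M : uq_model k A).

Fixpoint xeval (x : expr k) : A :=
  match x with
  | xscal c => m_sc M c
  | xe i => m_e M i
  | xf i => m_f M i
  | xK h => m_K M h
  | xadd x y => xeval x + xeval y
  | xmul x y => xeval x * xeval y
  end.

Lemma xeval_ueq x y : ueq x y -> xeval x = xeval y.
Proof.
elim=> //= {x y}; rewrite ?rmorphN1 ?rmorph0 ?rmorph1.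
- by move=> x y z _ -> _ ->.
- by move=> x x' y y' _ -> _ ->.
- by move=> x x' y y' _ -> _ ->.
- by move=> x y z; rewrite addrA.
- by move=> x y; rewrite addrC.
- by move=> x; rewrite add0r.
- by move=> x; rewrite mulN1r addNr.
- by move=> x y z; rewrite mulrA.
- by move=> x; rewrite mul1r.
- by move=> x y z; rewrite mulrDl.
- by move=> x y z; rewrite mulrDr.
- by move=> c d; rewrite rmorphD.
- by move=> c d; rewrite rmorphM.
- by move=> c x; rewrite m_scC.
- exact: m_K0.
- by move=> h h'; rewrite m_KD.
- by move=> h i; rewrite m_Ke.
- by move=> h i; rewrite m_Kf.
- by move=> i j; rewrite !mulN1r m_ef.
- by move=> i j ij; rewrite rmorphN mulNr m_serre_e.
- by move=> i j ij; rewrite rmorphN mulNr m_serre_f.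
- by move=> i j ij; rewrite m_comm_e.
- by move=> i j ij; rewrite m_comm_f.
Qed.

End Eval.

Section CounitModel.
Variable k : nat.
Let zf (_ : 'I_k.-1) : Qq := 0.
Let of_ (_ : coweight k) : Qq := 1.
Program Definition counit_model : uq_model k Qq :=
  @UqModel k Qq idfun zf zf of_ _ _ _ _ _ _ _ _ _ _.
Next Obligation. by rewrite mulrC. Qed.
Next Obligation. by rewrite /of_ mulr1. Qed.
Next Obligation. by rewrite /zf !(mulr0, mul0r). Qed.
Next Obligation. by rewrite /zf !(mulr0, mul0r). Qed.
Next Obligation. by rewrite /zf /of_ !(mulr0, mul0r) !subrr mulr0. Qed.
Next Obligation. by rewrite /zf !(mulr0, mul0r) subrr addr0. Qed.
Next Obligation. by rewrite /zf !(mulr0, mul0r) subrr addr0. Qed.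
End CounitModel.

HB.instance Definition _ (k : nat) := gen_eqMixin (expr k).
HB.instance Definition _ (k : nat) := gen_choiceMixin (expr k).

Section Quotient.
Variable k : nat.

Definition ueqb : rel (expr k) := fun x y => `[< ueq x y >].
Fact ueqb_refl : reflexive ueqb.
Proof. by move=> x; apply/asboolP; apply: ueq_refl. Qed.
Fact ueqb_sym : symmetric ueqb.
Proof. by move=> x y; apply/asboolP/asboolP; apply: ueq_sym. Qed.
Fact ueqb_trans : transitive ueqb.
Proof.
by move=> y x z /asboolP xy /asboolP yz; apply/asboolP; apply: ueq_trans yz.
Qed.
Canonical ueqb_equiv := EquivRel ueqb ueqb_refl ueqb_sym ueqb_trans.

Definition Uq : Type := {eq_quot ueqb}.
HB.instance Definition _ : EqQuotient _ ueqb Uq := EqQuotient.on Uq.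
HB.instance Definition _ := Choice.on Uq.

Lemma piU_eq (x y : expr k) : \pi_Uq x = \pi_Uq y <-> ueq x y.
Proof.
by split=> [/eqmodP /asboolP|xy] //; apply/eqmodP/asboolP.
Qed.
Lemma reprU (x : expr k) : ueq (repr (\pi_Uq x)) x.
Proof. by apply/piU_eq; rewrite reprK. Qed.

Definition uzero : Uq := \pi_Uq (xscal 0).
Definition uone : Uq := \pi_Uq (xscal 1).
Definition uadd : Uq -> Uq -> Uq := lift_op2 Uq (@xadd k).
Definition umul : Uq -> Uq -> Uq := lift_op2 Uq (@xmul k).
Definition uopp (x : Uq) : Uq := umul (\pi_Uq (xscal (-1))) x.
Definition uscale (c : Qq) (x : Uq) : Uq := umul (\pi_Uq (xscal c)) x.

Lemma uaddE x y : uadd (\pi_Uq x) (\pi_Uq y) = \pi_Uq (xadd x y).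
Proof. by unlock uadd; apply/piU_eq; apply: ueq_add; apply: reprU. Qed.
Lemma umulE x y : umul (\pi_Uq x) (\pi_Uq y) = \pi_Uq (xmul x y).
Proof. by unlock umul; apply/piU_eq; apply: ueq_mul; apply: reprU. Qed.

Fact uaddA : associative uadd.
Proof.
elim/quotW=> x; elim/quotW=> y; elim/quotW=> z; rewrite !uaddE.
by apply/piU_eq; apply: ueq_addA.
Qed.
Fact uaddC : commutative uadd.
Proof. by elim/quotW=> x; elim/quotW=> y; rewrite !uaddE; apply/piU_eq; apply: ueq_addC. Qed.
Fact uadd0 : left_id uzero uadd.
Proof. by elim/quotW=> x; rewrite uaddE; apply/piU_eq; apply: ueq_add0. Qed.
Fact uaddN : left_inverse uzero uopp uadd.
Proof. by elim/quotW=> x; rewrite /uopp umulE uaddE; apply/piU_eq; apply: ueq_addN. Qed.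
HB.instance Definition _ := GRing.isZmodule.Build Uq uaddA uaddC uadd0 uaddN.

Fact umulA : associative umul.
Proof.
elim/quotW=> x; elim/quotW=> y; elim/quotW=> z; rewrite !umulE.
by apply/piU_eq; apply: ueq_mulA.
Qed.
Fact umul1l : left_id uone umul.
Proof. by elim/quotW=> x; rewrite umulE; apply/piU_eq; apply: ueq_mul1l. Qed.
Fact umul1r : right_id uone umul.
Proof.
elim/quotW=> x; rewrite umulE; apply/piU_eq.
by apply: ueq_trans (ueq_mul1l x); apply: ueq_sym; apply: ueq_scalC.
Qed.
Fact umulDl : left_distributive umul uadd.
Proof.
elim/quotW=> x; elim/quotW=> y; elim/quotW=> z; rewrite !(uaddE, umulE).
by apply/piU_eq; apply: ueq_mulDl.
Qed.
Fact umulDr : right_distributive umul uadd.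
Proof.
elim/quotW=> x; elim/quotW=> y; elim/quotW=> z; rewrite !(uaddE, umulE).
by apply/piU_eq; apply: ueq_mulDr.
Qed.
Fact uone_neq0 : uone != uzero.
Proof.
apply/eqP => /piU_eq /(xeval_ueq (counit_model k)) /= /eqP.
by rewrite oner_eq0.
Qed.
HB.instance Definition _ :=
  GRing.Zmodule_isNzRing.Build Uq umulA umul1l umul1r umulDl umulDr uone_neq0.

Fact uscaleA c d x : uscale c (uscale d x) = uscale (c * d) x.
Proof.
rewrite /uscale umulA umulE; congr (umul _ _); apply/piU_eq.
by apply: ueq_sym; apply: ueq_scalM.
Qed.
Fact uscale1 : left_id 1 uscale.
Proof. exact: umul1l. Qed.
Fact uscaleDr : right_distributive uscale +%R.
Proof. by move=> c x y; apply: umulDr. Qed.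
Fact uscaleDl x : {morph uscale^~ x : c d / c + d}.
Proof.
move=> c d; rewrite -[RHS]/(uadd _ _) /uscale -umulDl; congr (umul _ _).
by rewrite uaddE; apply/piU_eq; apply: ueq_scalD.
Qed.
HB.instance Definition _ :=
  GRing.Zmodule_isLmodule.Build Qq Uq uscaleA uscale1 uscaleDr uscaleDl.
Fact uscaleAl (c : Qq) (x y : Uq) : c *: (x * y) = (c *: x) * y.
Proof. exact: umulA. Qed.
HB.instance Definition _ := GRing.Lmodule_isLalgebra.Build Qq Uq uscaleAl.
Fact uscaleAr (c : Qq) (x y : Uq) : c *: (x * y) = x * (c *: y).
Proof.
rewrite -[LHS]/(umul _ (umul _ _)) -[RHS]/(umul _ (umul _ _)) !umulA.
congr (umul _ _); elim/quotW: x => x; rewrite !umulE.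
by apply/piU_eq; apply: ueq_scalC.
Qed.
HB.instance Definition _ := GRing.Lalgebra_isAlgebra.Build Qq Uq uscaleAr.

Definition Ue (i : 'I_k.-1) : Uq := \pi_Uq (xe i).
Definition Uf (i : 'I_k.-1) : Uq := \pi_Uq (xf i).
Definition UK (h : coweight k) : Uq := \pi_Uq (@xK k h).

Lemma piU_scal c : \pi_Uq (xscal c) = c%:A.
Proof. by rewrite -[RHS]/(umul _ uone) umul1r. Qed.
Lemma piU_add x y : \pi_Uq (xadd x y) = \pi_Uq x + \pi_Uq y.
Proof. by rewrite -uaddE. Qed.
Lemma piU_mul x y : \pi_Uq (xmul x y) = \pi_Uq x * \pi_Uq y.
Proof. by rewrite -umulE. Qed.
Definition piUE := (piU_scal, piU_add, piU_mul).

End Quotient.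

Arguments Ue {k} i.
Arguments Uf {k} i.
Arguments UK {k} h.

Section Relations.
Variable k : nat.
Implicit Types (h : coweight k) (i j : 'I_k.-1).

Lemma UK0 : UK 0 = 1 :> Uq k.
Proof. by apply/piU_eq; apply: ueq_K0. Qed.
Lemma UKD h h' : UK h * UK h' = UK (h + h').
Proof. by rewrite -piU_mul; apply/piU_eq; apply: ueq_KD. Qed.
Lemma UKe h i : UK h * Ue i * UK (- h) = q ^ pair (alpha i) h *: Ue i.
Proof.
by rewrite -mulr_algl -!piUE; apply/piU_eq; apply: ueq_Ke.
Qed.
Lemma UKf h i : UK h * Uf i * UK (- h) = q ^ (- pair (alpha i) h) *: Uf i.
Proof.
by rewrite -mulr_algl -!piUE; apply/piU_eq; apply: ueq_Kf.
Qed.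
Lemma Uef i j : Ue i * Uf j - Uf j * Ue i =
  (i == j)%:R *: qbracket (UK (coroot i)) (UK (- coroot i)) 0.
Proof.
rewrite /qbracket oppr0 expr0z !scale1r scalerA.
have -> : (i == j)%:R * (q - q^-1)^-1 = if i == j then (q - q^-1)^-1 else 0.
  by case: eqP => _; rewrite ?mul1r ?mul0r.
rewrite -mulr_algl -[- (_ * _)]mulN1r -[- UK _]mulN1r -scaleN1r -!piUE.
by apply/piU_eq; apply: ueq_ef.
Qed.
Lemma Userre_e i j : (i.+1 == j)%N || (j.+1 == i)%N ->
  Ue i ^+ 2 * Ue j - (q + q^-1) *: (Ue i * Ue j * Ue i) + Ue j * Ue i ^+ 2 = 0.
Proof.
move=> ij; rewrite -scaleNr -mulr_algl !expr2 mulrA -!piUE -(scale0r 1) -piU_scal.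
by apply/piU_eq; apply: ueq_serre_e.
Qed.
Lemma Userre_f i j : (i.+1 == j)%N || (j.+1 == i)%N ->
  Uf i ^+ 2 * Uf j - (q + q^-1) *: (Uf i * Uf j * Uf i) + Uf j * Uf i ^+ 2 = 0.
Proof.
move=> ij; rewrite -scaleNr -mulr_algl !expr2 mulrA -!piUE -(scale0r 1) -piU_scal.
by apply/piU_eq; apply: ueq_serre_f.
Qed.
Lemma Ucomm_e i j : (i.+1 < j)%N || (j.+1 < i)%N -> Ue i * Ue j = Ue j * Ue i.
Proof. by move=> ij; rewrite -!piUE; apply/piU_eq; apply: ueq_comm_e. Qed.
Lemma Ucomm_f i j : (i.+1 < j)%N || (j.+1 < i)%N -> Uf i * Uf j = Uf j * Uf i.
Proof. by move=> ij; rewrite -!piUE; apply/piU_eq; apply: ueq_comm_f. Qed.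

End Relations.

Section Lift.
Variables (k : nat) (A : pzRingType) (M : uq_model k A).

Definition Ulift (x : Uq k) : A := xeval M (repr x).

Lemma Ulift_pi x : Ulift (\pi_(Uq k) x) = xeval M x.
Proof. by apply: xeval_ueq; apply: reprU. Qed.
Fact Ulift_zmod_morphism : zmod_morphism Ulift.
Proof.
elim/quotW=> x; elim/quotW=> y.
rewrite -scaleN1r -mulr_algl -!piUE !Ulift_pi /= rmorphN1.
by rewrite mulN1r.
Qed.
Fact Ulift_monoid_morphism : monoid_morphism Ulift.
Proof.
split; first by rewrite -(scale1r 1) -piU_scal Ulift_pi /= rmorph1.
by elim/quotW=> x; elim/quotW=> y; rewrite -piUE !Ulift_pi.
Qed.
HB.instance Definition _ := GRing.isZmodMorphism.Build (Uq k) A Ulift Ulift_zmod_morphism.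
HB.instance Definition _ := GRing.isMonoidMorphism.Build (Uq k) A Ulift Ulift_monoid_morphism.

Lemma Ulift_e i : Ulift (Ue i) = m_e M i. Proof. exact: Ulift_pi. Qed.
Lemma Ulift_f i : Ulift (Uf i) = m_f M i. Proof. exact: Ulift_pi. Qed.
Lemma Ulift_K h : Ulift (UK h) = m_K M h. Proof. exact: Ulift_pi. Qed.
Lemma Ulift_scal c : Ulift c%:A = m_sc M c.
Proof. by rewrite -piU_scal Ulift_pi. Qed.
End Lift.

Section BarAnti.
Variable k : nat.

Definition bar_sc (c : Qq) : Uq k := (barQ c)%:A.
HB.instance Definition _ := GRing.RMorphism.copy bar_sc (in_alg (Uq k) \o barQ).

Definition anti_sc (c : Qq) : (Uq k)^c := (c%:A : Uq k).
Fact anti_sc_zmod : zmod_morphism anti_sc.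
Proof. by move=> c d; rewrite /anti_sc scalerBl. Qed.
Fact anti_sc_monoid : monoid_morphism anti_sc.
Proof.
split=> [|c d]; first exact: scale1r.
rewrite /anti_sc -[RHS]/((d%:A : Uq k) * c%:A).
by rewrite mulr_algl scalerA mulrC.
Qed.
HB.instance Definition _ := GRing.isZmodMorphism.Build Qq (Uq k)^c anti_sc anti_sc_zmod.
HB.instance Definition _ := GRing.isMonoidMorphism.Build Qq (Uq k)^c anti_sc anti_sc_monoid.

Lemma barQ_qV : barQ q^-1 = q.
Proof. by rewrite fmorphV /= barQ_q invrK. Qed.
Lemma barQ_qX (n : int) : barQ (q ^ n) = q ^ (- n).
Proof. by rewrite (rmorphXz barQ) /= ?barQ_q ?exprzN ?exprz_inv // unitfE q_neq0. Qed.

Lemma pairN (mu : weight k) (h : coweight k) : pair mu (- h) = - pair mu h.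
Proof. by rewrite -sumrN; apply: eq_bigr => j _; rewrite mxE mulrN. Qed.

Program Definition bar_model : uq_model k (Uq k) :=
  @UqModel k (Uq k) bar_sc Ue Uf (fun h => UK (- h)) _ _ _ _ _ _ _ _ _ _.
Next Obligation. by rewrite /bar_sc mulr_algl mulr_algr. Qed.
Next Obligation. by rewrite oppr0 UK0. Qed.
Next Obligation. by rewrite UKD opprD. Qed.
Next Obligation. by rewrite UKe /bar_sc barQ_qX pairN mulr_algl. Qed.
Next Obligation. by rewrite UKf /bar_sc barQ_qX pairN mulr_algl. Qed.
Next Obligation.
rewrite Uef /bar_sc mulr_algl /qbracket oppr0 expr0z !scale1r opprK.
case: eqP => _; last by rewrite (rmorph0 barQ) !scale0r.
rewrite scale1r fmorphV rmorphB /= barQ_qV barQ_q -opprB invrN scaleNr -scalerN.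
by rewrite opprB.
Qed.
Next Obligation.
rewrite /bar_sc (rmorphD barQ) /= barQ_qV barQ_q mulr_algl [q^-1 + q]addrC.
by rewrite -[RHS](Userre_e H) !expr2 !mulrA.
Qed.
Next Obligation.
rewrite /bar_sc (rmorphD barQ) /= barQ_qV barQ_q mulr_algl [q^-1 + q]addrC.
by rewrite -[RHS](Userre_f H) !expr2 !mulrA.
Qed.
Next Obligation. by rewrite Ucomm_e. Qed.
Next Obligation. by rewrite Ucomm_f. Qed.

Program Definition anti_model : uq_model k (Uq k)^c :=
  @UqModel k (Uq k)^c anti_sc Uf Ue UK _ _ _ _ _ _ _ _ _ _.
Next Obligation.
by rewrite -[LHS]/((x : Uq k) * c%:A) -[RHS]/((c%:A : Uq k) * x) mulr_algl mulr_algr.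
Qed.
Next Obligation. exact: UK0. Qed.
Next Obligation. by rewrite -[LHS]/((UK h' : Uq k) * UK h) UKD addrC. Qed.
Next Obligation.
rewrite -[LHS]/((UK (- h) : Uq k) * (Uf i * UK h)) -[RHS]/((Uf i : Uq k) * _%:A).
by rewrite mulr_algr mulrA -{2}(opprK h) UKf pairN opprK.
Qed.
Next Obligation.
rewrite -[LHS]/((UK (- h) : Uq k) * (Ue i * UK h)) -[RHS]/((Ue i : Uq k) * _%:A).
by rewrite mulr_algr mulrA -{2}(opprK h) UKe pairN.
Qed.
Next Obligation.
rewrite -[LHS]/((Ue j : Uq k) * Uf i - Uf i * Ue j).
rewrite -[RHS]/((UK (coroot i) - UK (- coroot i) : Uq k) * _%:A).
rewrite Uef mulr_algr /qbracket oppr0 expr0z !scale1r eq_sym.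
by case: eqP => [->|_]; rewrite ?scale1r ?scale0r.
Qed.
Next Obligation.
rewrite -[LHS]/((Uf j : Uq k) * (Uf i * Uf i) - (Uf i * (Uf j * Uf i)) * _%:A
                + Uf i * (Uf i * Uf j)).
rewrite mulr_algr -[RHS](Userre_f H) !expr2 !mulrA.
by rewrite addrAC [RHS]addrAC [X in X - _]addrC.
Qed.
Next Obligation.
rewrite -[LHS]/((Ue j : Uq k) * (Ue i * Ue i) - (Ue i * (Ue j * Ue i)) * _%:A
                + Ue i * (Ue i * Ue j)).
rewrite mulr_algr -[RHS](Userre_e H) !expr2 !mulrA.
by rewrite addrAC [RHS]addrAC [X in X - _]addrC.
Qed.
Next Obligation.
by rewrite -[LHS]/((Uf j : Uq k) * Uf i) -[RHS]/((Uf i : Uq k) * Uf j) (Ucomm_f H).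
Qed.
Next Obligation.
by rewrite -[LHS]/((Ue j : Uq k) * Ue i) -[RHS]/((Ue i : Uq k) * Ue j) (Ucomm_e H).
Qed.

(* The bar involution psi, a Q-algebra automorphism with psi(q) = q^-1, and   *)
(* the Q(q)-linear antiautomorphism phi exchanging e_i and f_i.               *)
Definition bar : Uq k -> Uq k := Ulift bar_model.
HB.instance Definition _ := GRing.RMorphism.on bar.
Definition anti : Uq k -> Uq k := Ulift anti_model.

Lemma bar_e i : bar (Ue i) = Ue i. Proof. exact: Ulift_e. Qed.
Lemma bar_f i : bar (Uf i) = Uf i. Proof. exact: Ulift_f. Qed.
Lemma bar_K h : bar (UK h) = UK (- h). Proof. exact: Ulift_K. Qed.
Lemma bar_scal c : bar c%:A = (barQ c)%:A. Proof. exact: Ulift_scal. Qed.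

Lemma anti_e i : anti (Ue i) = Uf i. Proof. exact: (Ulift_e anti_model). Qed.
Lemma anti_f i : anti (Uf i) = Ue i. Proof. exact: (Ulift_f anti_model). Qed.
Lemma anti_K h : anti (UK h) = UK h. Proof. exact: (Ulift_K anti_model). Qed.
Lemma anti_scal c : anti c%:A = c%:A. Proof. exact: (Ulift_scal anti_model). Qed.
Lemma antiB x y : anti (x - y) = anti x - anti y. Proof. exact: (rmorphB (Ulift anti_model)). Qed.
Lemma antiM x y : anti (x * y) = anti y * anti x. Proof. exact: (rmorphM (Ulift anti_model)). Qed.

End BarAnti.

(* U_q(sl_(k-1)) -> U_q(sl_k), with image the subalgebra generated by the     *)
(* e_i, f_i (1 <= i <= k-2) and q^h (h in Z h_1 + ... + Z h_(k-2)).           *)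
Section Inclusion.
Variable k : nat.
Local Notation U := (Uq k).

Definition up_node (i : 'I_k.-1.-1) : 'I_k.-1 := widen_ord (leq_pred k.-1) i.
Definition up_coweight (h : coweight k.-1) : coweight k :=
  \sum_(i < k.-1.-1) h 0 i *: coroot (up_node i).

Fact up_coweight0 : up_coweight 0 = 0.
Proof. by rewrite /up_coweight big1 // => i _; rewrite mxE scale0r. Qed.
Fact up_coweightD h h' : up_coweight (h + h') = up_coweight h + up_coweight h'.
Proof. by rewrite -big_split; apply: eq_bigr => i _; rewrite mxE scalerDl. Qed.
Fact up_coweightN h : up_coweight (- h) = - up_coweight h.
Proof. by rewrite -sumrN; apply: eq_bigr => i _; rewrite mxE scaleNr. Qed.
Fact up_coroot i : up_coweight (coroot i) = coroot (up_node i).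
Proof.
rewrite /up_coweight (bigD1 i) //= mxE !eqxx scale1r big1 ?addr0 // => j ne_ji.
by rewrite mxE (negPf ne_ji) andbF scale0r.
Qed.
Fact pair_up i h : pair (alpha (up_node i)) (up_coweight h) = pair (alpha i) h.
Proof.
rewrite /pair /up_coweight.
transitivity (\sum_(j < k.-1) \sum_(l < k.-1.-1)
    alpha (up_node i) 0 j * (h 0 l * (j == up_node l)%:R)).
  apply: eq_bigr => j _; rewrite summxE mulr_sumr; apply: eq_bigr => l _.
  by rewrite !mxE eqxx.
rewrite exchange_big; apply: eq_bigr => l _.
rewrite (bigD1 (up_node l)) //= eqxx mulr1 big1 ?addr0 => [|j /negPf->].
  by rewrite !mxE.
by rewrite !mulr0.
Qed.

Program Definition incl_model : uq_model k.-1 U :=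
  @UqModel k.-1 U (in_alg U) (fun i => Ue (up_node i)) (fun i => Uf (up_node i))
    (fun h => UK (up_coweight h)) _ _ _ _ _ _ _ _ _ _.
Next Obligation. by rewrite mulr_algl mulr_algr. Qed.
Next Obligation. by rewrite up_coweight0 UK0. Qed.
Next Obligation. by rewrite UKD up_coweightD. Qed.
Next Obligation. by rewrite up_coweightN UKe pair_up mulr_algl. Qed.
Next Obligation. by rewrite up_coweightN UKf pair_up mulr_algl. Qed.
Next Obligation.
rewrite up_coweightN !up_coroot Uef mulr_algl /qbracket oppr0 expr0z !scale1r.
have -> : (up_node i == up_node j) = (i == j) by [].
by case: eqP => _; rewrite ?scale1r ?scale0r.
Qed.
Next Obligation.
by rewrite mulr_algl -[RHS](@Userre_e k (up_node i) (up_node j) H) !expr2 !mulrA.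
Qed.
Next Obligation.
by rewrite mulr_algl -[RHS](@Userre_f k (up_node i) (up_node j) H) !expr2 !mulrA.
Qed.
Next Obligation. exact: Ucomm_e. Qed.
Next Obligation. exact: Ucomm_f. Qed.

Definition incl : Uq k.-1 -> Uq k := Ulift incl_model.
HB.instance Definition _ := GRing.RMorphism.on incl.

Lemma incl_e i : incl (Ue i) = Ue (up_node i). Proof. exact: Ulift_e. Qed.
Lemma incl_f i : incl (Uf i) = Uf (up_node i). Proof. exact: Ulift_f. Qed.
Lemma incl_K h : incl (UK h) = UK (up_coweight h). Proof. exact: Ulift_K. Qed.
Lemma incl_scal c : incl c%:A = c%:A. Proof. exact: Ulift_scal. Qed.

End Inclusion.

Definition ediv k (i : 'I_k.-1) (n : nat) : Uq k := (qfact n)^-1 *: Ue i ^+ n.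
Definition fdiv k (i : 'I_k.-1) (n : nat) : Uq k := (qfact n)^-1 *: Uf i ^+ n.

(* [q^h; 0] [q^h; -1] ... [q^h; 1-n] / [n]! *)
Definition Kdiv k (h : coweight k) (n : nat) : Uq k :=
  (qfact n)^-1 *: \prod_(0 <= t < n) qbracket (UK h) (UK (- h)) (- t%:Z).

Inductive UA k : set (Uq k) :=
| UA_scal c of Alaur c : UA c%:A
| UA_e i n of (0 < n)%N : UA (ediv i n)
| UA_f i n of (0 < n)%N : UA (fdiv i n)
| UA_K h : UA (UK h)
| UA_Kdiv h n of (0 < n)%N : UA (Kdiv h n)
| UA_add x y of UA x & UA y : UA (x + y)
| UA_mul x y of UA x & UA y : UA (x * y).

Record Urep (k : nat) (V : vectType Qq) := {
  act :> Uq k -> 'End(V);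
  act_linear : linear act;
  act1 : act 1 = \1%VF;
  actM : forall x y, act (x * y) = (act x \o act y)%VF
}.

Definition basis_over (V : vectType Qq) (S : set Qq) (X : set V)
    (I : finType) (g : I -> V) : Prop :=
  (forall x, X x <->
     exists2 c : I -> Qq, (forall i, S (c i)) & x = \sum_i c i *: g i) /\
  (forall c : I -> Qq, (forall i, S (c i)) -> \sum_i c i *: g i = 0 ->
     forall i, c i = 0).

(* The class of x in L/qL; elements of L/qL are handled as cosets in V. *)
Definition coset (V : vectType Qq) (L : set V) (x : V) : set V :=
  [set y | exists2 z, L z & y = x + q *: z].

(* The image of a class c under the map L/qL -> L'/qL' induced by T. *)
Definition coset_map (V W : vectType Qq) (L' : set W) (T : V -> W) (c : set V) :
    set W :=
  [set y | exists2 x, c x & coset L' (T x) y].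

(* cls lists a Q-basis of L/qL. *)
Definition quotient_basis (V : vectType Qq) (L : set V)
    (B : finType) (cls : B -> set V) : Prop :=
  (forall b, exists2 x, L x & cls b = coset L x) /\
  (forall r : B -> V, (forall b, cls b (r b)) -> forall x, L x ->
     exists! c : {ffun B -> rat},
       coset L x = coset L (\sum_b of_rat (c b) *: r b)).

Section Crystal.
Variables (k : nat) (V : vectType Qq) (rho : Urep k V).
Implicit Types (mu : weight k) (L : set V) (et ft : 'I_k.-1 -> 'End(V)).

Definition weight_space mu : set V :=
  [set v | forall h, rho (UK h) v = q ^ pair mu h *: v].

(* X is the sum of the X `&` V_mu. The sum is automatically direct, as q is   *)
(* not a root of unity.                                                       *)
Definition graded (X : set V) : Prop := forall v, X v ->
  exists (s : seq (weight k)) (w : weight k -> V),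
    (forall mu, (X `&` weight_space mu)%classic (w mu)) /\
    v = \sum_(mu <- s) w mu.

Definition irreducible : Prop :=
  (exists v : V, v != 0) /\
  (forall W : {vspace V}, (forall x, (rho x @: W <= W)%VS) ->
     W = 0%VS \/ W = fullv).

Definition string_decomposition (i : 'I_k.-1) mu (u : V) (N : nat)
    (w : nat -> V) : Prop :=
  (forall n, (n <= N)%N ->
     [/\ weight_space (mu + alpha i *+ n) (w n), rho (Ue i) (w n) = 0
       & rho (fdiv i n) (w n) = 0 -> w n = 0]) /\
  u = \sum_(0 <= n < N.+1) rho (fdiv i n) (w n).

Definition kashiwara et ft : Prop :=
  forall i mu u N w, weight_space mu u -> string_decomposition i mu u N w ->
    et i u = \sum_(1 <= n < N.+1) rho (fdiv i n.-1) (w n) /\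
    ft i u = \sum_(0 <= n < N.+1) rho (fdiv i n.+1) (w n).

(* An A_0-basis of L that is a Q(q)-basis of V expresses both that L is free  *)
(* and that Q(q) (x) L -> V is an isomorphism.                                *)
Definition crystal_lattice et ft L : Prop :=
  [/\ exists (n : nat) (g : 'I_n -> V),
        basis_over A0 L g /\ basis_over setT setT g,
      graded L,
      forall i x, L x -> L (et i x)
    & forall i x, L x -> L (ft i x)].

Definition class_weight L (c : set V) mu : Prop :=
  exists x, [/\ L x, weight_space mu x & c = coset L x].

Definition crystal_basis et ft L (B : finType) (cls : B -> set V) : Prop :=
  [/\ crystal_lattice et ft L,
      quotient_basis L cls,
      forall b, exists! mu, class_weight L (cls b) mu,
      forall i b,
        (coset_map L (et i) (cls b) = coset L 0 \/
         exists b', coset_map L (et i) (cls b) = cls b') /\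
        (coset_map L (ft i) (cls b) = coset L 0 \/
         exists b', coset_map L (ft i) (cls b) = cls b')
    & forall i b b', coset_map L (ft i) (cls b) = cls b' <->
                     coset_map L (et i) (cls b') = cls b].

Definition normalized (lam : weight k) (v : V) L (B : finType)
    (cls : B -> set V) : Prop :=
  (L `&` weight_space lam = [set c *: v | c in A0])%classic /\
  (forall b, class_weight L (cls b) lam <-> cls b = coset L v) /\
  (exists b, cls b = coset L v).

(* The map induced by the bar involution on V = U_q v. *)
Definition bar_map (v : V) (psi : V -> V) : Prop :=
  forall x, psi (rho x v) = rho (bar x) v.

Definition lower_global (v : V) (psi : V -> V) L (B : finType)
    (cls : B -> set V) (G : B -> V) : Prop :=
  [/\ basis_over A0 L G,
      basis_over Qsub
        ([set rho x v | x in @UA k] `&` L `&` [set psi x | x in L])%classic G,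
      forall b, coset L (G b) = cls b
    & forall b, psi (G b) = G b].

Definition shapovalov (v : V) (form : V -> V -> Qq) : Prop :=
  [/\ forall x y, form x y = form y x,
      forall c x x' y, form (c *: x + x') y = c * form x y + form x' y,
      form v v = 1
    & forall p x y, form (rho p x) y = form x (rho (anti p) y)].

Definition upper_global (form : V -> V -> Qq) (B : finType) (G F : B -> V) :
    Prop :=
  basis_over setT setT F /\ (forall b b', form (F b) (G b') = (b == b')%:R).

End Crystal.

Record hwrep (k : nat) (lam : weight k) := {
  hw_space :> vectType Qq;
  hw_act : Urep k hw_space;
  hw_vec : hw_space;
  hw_graded : graded hw_act setT;
  hw_irreducible : irreducible hw_act;
  hw_vec_neq0 : hw_vec != 0;
  hw_vec_weight : weight_space hw_act lam hw_vec;
  hw_vec_e : forall i, hw_act (Ue i) hw_vec = 0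
}.
Arguments hw_act {k lam} h.
Arguments hw_vec {k lam} h.

(* B^lam is indexed by the finite type br_B: b stands for the class           *)
(* br_class b in L/qL. All data are determined, up to the choice of br_B, by  *)
(* the representation and its highest weight vector.                          *)
Record based_rep (k : nat) (lam : weight k) := {
  br_rep :> hwrep lam;
  br_e : 'I_k.-1 -> 'End(br_rep);
  br_f : 'I_k.-1 -> 'End(br_rep);
  br_L : set br_rep;
  br_B : finType;
  br_class : br_B -> set br_rep;
  br_psi : br_rep -> br_rep;
  br_form : br_rep -> br_rep -> Qq;
  br_G : br_B -> br_rep;
  br_F : br_B -> br_rep;
  br_kashiwara : kashiwara (hw_act br_rep) br_e br_f;
  br_crystal : crystal_basis (hw_act br_rep) br_e br_f br_L br_class;
  br_normalized :
    normalized (hw_act br_rep) lam (hw_vec br_rep) br_L br_class;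
  br_bar : bar_map (hw_act br_rep) (hw_vec br_rep) br_psi;
  br_shapovalov : shapovalov (hw_act br_rep) (hw_vec br_rep) br_form;
  br_lower :
    lower_global (hw_act br_rep) (hw_vec br_rep) br_psi br_L br_class br_G;
  br_upper : upper_global br_form br_G br_F
}.
Arguments br_L {k lam} b.
Arguments br_B {k lam} b.
Arguments br_class {k lam} b.
Arguments br_form {k lam} b.
Arguments br_F {k lam} b.

(* f_(k-1)^(j) f_(k-2)^(j) ... f_a^(j) v *)
Definition vj k (lam : weight k) (M : hwrep lam) (a j : nat) : M :=
  hw_act M (\prod_(i <- rev (enum 'I_k.-1) | (a <= i.+1)%N) fdiv i j) (hw_vec M).

Definition lamj (k a m j : nat) : weight k.-1 :=
  omega k.-1 a.-1 *+ j + omega k.-1 a *+ (m - j).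

(* phi is the isomorphism of U_q(sl_(k-1))-representations from N onto        *)
(* U_q(sl_(k-1)) v sending the highest weight vector to v.                    *)
Definition restriction_iso k (lam : weight k) (lam' : weight k.-1)
    (M : hwrep lam) (N : hwrep lam') (v : M) (phi : 'Hom(N, M)) : Prop :=
  [/\ injective phi,
      range phi = [set hw_act M (incl x) v | x in setT]%classic,
      forall x u, phi (hw_act N x u) = hw_act M (incl x) (phi u)
    & phi (hw_vec N) = v].

(* Main.v *)
Require Import Defs.
From HB Require Import structures.
From mathcomp Require Import all_boot all_order all_algebra.
From mathcomp Require Import boolp classical_sets.
From mathcomp Require Import ring.

Set Implicit Arguments.
Unset Strict Implicit.
Unset Printing Implicit Defensive.

Import GRing.Theory.
Local Open Scope ring_scope.

(** U_q(sl_k) v_lambda is spanned by words in the f_i, and the Serre relations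
    alone turn such a word into a combination of words whose factors f_(k-1) are
    all adjacent. Applied in every rank, this shows that V^lambda is the sum of the
    submodules U_q(sl_(k-1)) v_j. They are eigenspaces, for distinct
    eigenvalues, of a torus element commuting with U_q(sl_(k-1)), hence mutually
    orthogonal, and on each of them the Shapovalov form of V^lambda is (v_j,v_j)
    times that of the irreducible representation with highest weight lambda^j.
    Since v_j is bar-invariant and lies in U_A v_lambda, the uniqueness of the
    lower global basis gives phi_j(G_b) = G_(phi_j(b)); the theorem follows by
    duality. *)

(** * Arithmetic of q-integers *)

Lemma q_expz_eq1 (z : int) : q ^ z = 1 -> z = 0.
Proof.
have pos n : q ^+ n = 1 -> n = 0%N.
  rewrite /q -(rmorphXn of_poly) -(rmorph1 of_poly) => /of_poly_eq.
  by move/(congr1 (fun p : {poly rat} => size p)); rewrite size_polyXn size_poly1 => -[].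
case: z => n; first by move=> e; rewrite (pos n e).
by rewrite NegzE -exprnN => /(congr1 GRing.inv); rewrite invrK invr1 => /pos.
Qed.

Lemma q_expz_inj (s t : int) : q ^ s = q ^ t -> s = t.
Proof.
move=> e; apply/eqP; rewrite -subr_eq0; apply/eqP; apply: q_expz_eq1.
by rewrite expfzDr ?q_neq0 // e -expfzDr ?q_neq0 // subrr.
Qed.

Lemma q_subV_neq0 : q - q^-1 != 0.
Proof.
rewrite subr_eq0; apply/eqP => e.
have := @q_expz_inj 1 (- 1); rewrite exprN1 expr1z => /(_ e).
by [].
Qed.

Lemma qintE n : qint n = (q - q^-1)^-1 * (q ^ n%:Z - q ^ (- n%:Z)).
Proof.
by rewrite /qint /qbracket -[LHS]/(_ * (q ^ n * 1 - q ^ (- n%:Z) * 1)) !mulr1.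
Qed.

Lemma qint0 : qint 0 = 0.
Proof. by rewrite qintE oppr0 subrr mulr0. Qed.

Lemma qint1 : qint 1 = 1.
Proof. by rewrite qintE expr1z exprN1 mulVf ?q_subV_neq0. Qed.

Lemma three_term_recurrence (F : fieldType) (x b c : F) : x != 0 ->
  x * (x * b) - x^-1 * (x^-1 * c)
  = (x + x^-1) * (x * b - x^-1 * c) - (b - c).
Proof. by move=> x0; field. Qed.

(** The coefficient is that of the Serre relation, which is how q-integers enter
    [serre_expand_left]. *)
Lemma qintSS n : qint n.+2 = (q + q^-1) * qint n.+1 - qint n.
Proof.
rewrite !qintE mulrCA -mulrBr; congr (_ * _).
rewrite !(intS n.+1) !(intS n) !opprD !expfzDr ?q_neq0 // !exprN1 !expr1z.
rewrite -opprD; exact: three_term_recurrence q_neq0.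
Qed.

Lemma qintS_neq0 n : qint n.+1 != 0.
Proof.
rewrite qintE; apply: mulf_neq0; first by rewrite invr_eq0 q_subV_neq0.
by rewrite subr_eq0; apply/eqP => /q_expz_inj.
Qed.

Lemma qfact_neq0 n : qfact n != 0.
Proof.
rewrite /qfact; elim: n => [|n IHn]; first by rewrite big_geq ?oner_neq0.
by rewrite big_nat_recr; first exact: mulf_neq0 IHn (qintS_neq0 n).
Qed.

Lemma barQ_qint n : barQ (qint n) = qint n.
Proof.
rewrite !qintE (rmorphM barQ) fmorphV !(rmorphB barQ) /= !barQ_qX barQ_q barQ_qV opprK.
by rewrite -mulrNN -[in LHS](invrN (q^-1 - q)) !opprB.
Qed.

Lemma barQ_qfact n : barQ (qfact n) = qfact n.
Proof.
rewrite /qfact (rmorph_prod barQ); apply: eq_bigr => t _; exact: barQ_qint.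
Qed.

(* The eigenvalues of K_i along an f_i-string of highest weight n are        *)
(* symmetric around 0, so their q-integers cancel.                            *)
Lemma qbracket_string_sum n :
  \sum_(0 <= s < n.+1)
    (q - q^-1)^-1 * (q ^ (n%:Z - s%:Z *+ 2) - q ^ (- (n%:Z - s%:Z *+ 2))) = 0.
Proof.
rewrite -mulr_sumr sumrB big_nat_rev /= add0n.
rewrite [X in _ * (X - _)](_ : _ =
  \sum_(0 <= s < n.+1) q ^ (- (n%:Z - s%:Z *+ 2))) ?subrr ?mulr0 //.
apply: eq_big_nat => s /andP[_ sn]; congr (q ^ _).
by rewrite subSS -subzn // mulrnBl opprB mulr2n; ring.
Qed.

(** * Quantum Serre relations in rank two *)

Definition serre (A : algType Qq) (x y : A) : Prop :=
  x ^+ 2 * y - (q + q^-1) *: (x * y * x) + y * x ^+ 2 = 0.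

Lemma serre0l (A : algType Qq) (x : A) : serre 0 x.
Proof. by rewrite /serre expr0n !(mul0r, mulr0) scaler0 subr0 addr0. Qed.

Lemma serre0r (A : algType Qq) (x : A) : serre x 0.
Proof. by rewrite /serre !(mul0r, mulr0) scaler0 subr0 addr0. Qed.

(** By induction on [t]: right multiplication by [x] creates [y * x ^+ 2] in the second term, and
    the Serre relation rewrites it. *)
Lemma serre_move_right (A : algType Qq) (x y : A) t : serre x y ->
  exists al be, y * x ^+ t.+1 = al *: (x ^+ t.+1 * y) + be *: (x ^+ t * (y * x)).
Proof.
move=> sxy; have yxx : y * x ^+ 2 = (q + q^-1) *: (x * y * x) - x ^+ 2 * y.
  by apply/eqP; rewrite -subr_eq0 opprB addrC sxy.
elim: t => [|t [al [be IHt]]].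
  by exists 0, 1; rewrite scale0r add0r scale1r expr1 expr0 mul1r.
exists (- be), (al + (q + q^-1) * be).
have e1 : x ^+ t * (x * y * x) = x ^+ t.+1 * (y * x) by rewrite !mulrA -exprSr.
have e2 : x ^+ t * (x ^+ 2 * y) = x ^+ t.+2 * y by rewrite mulrA -exprD addn2.
rewrite [in LHS]exprSr mulrA IHt mulrDl -!scalerAl -[x ^+ t.+1 * y * x]mulrA.
rewrite -[x ^+ t * _ * x]mulrA -[y * x * x]mulrA -expr2 yxx mulrBr -scalerAr.
rewrite e1 e2 scalerBr scalerA scalerDl scaleNr [be * _]mulrC.
by rewrite [RHS]addrC addrA.
Qed.

(** Left multiplication by [y] creates [y ^+ 2 * x]; after the Serre relation, [qintSS] recombines
    the coefficients. They are explicit because the identity is later solved for [y * x * y ^+ s],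
    dividing by [qint s.+1]. *)
Lemma serre_expand_left (A : algType Qq) (x y : A) s : serre y x ->
  y ^+ s.+1 * x = qint s.+1 *: (y * x * y ^+ s) - qint s *: (x * y ^+ s.+1).
Proof.
move=> syx; have yyx : y * (y * x) = (q + q^-1) *: (y * x * y) - x * y ^+ 2.
  by apply/eqP; rewrite -subr_eq0 opprB addrA addrAC mulrA -expr2 syx.
elim: s => [|s IHs].
  by rewrite qint0 qint1 scale0r subr0 scale1r expr1 expr0 mulr1.
have e1 : x * y ^+ 2 * y ^+ s = x * y ^+ s.+2 by rewrite -mulrA -exprD add2n.
have e2 : y * x * y * y ^+ s = y * x * y ^+ s.+1 by rewrite -mulrA -exprS.
have e3 : y * (x * y ^+ s.+1) = y * x * y ^+ s.+1 by rewrite mulrA.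
rewrite [in LHS]exprS -mulrA IHs mulrBr -!scalerAr mulrA yyx mulrBl -scalerAl.
rewrite e1 e2 e3 scalerBr scalerA qintSS scalerBl mulrC.
by rewrite addrAC.
Qed.

(** An inductive span works both in [Uq k], which is only an algebra, and in representations. *)
Inductive lspan (V : lmodType Qq) (P : V -> Prop) : V -> Prop :=
| lspan0 : lspan P 0
| lspan_cons c x y of P x & lspan P y : lspan P (c *: x + y).

Section LinearSpan.
Variable V : lmodType Qq.
Implicit Types (P : V -> Prop) (x y : V).

Lemma lspanD P x y : lspan P x -> lspan P y -> lspan P (x + y).
Proof.
move=> Px Py; elim: Px => [|c z t Pz _ IHt]; first by rewrite add0r.
by rewrite -addrA; apply: lspan_cons.
Qed.

Lemma lspanZ P c x : lspan P x -> lspan P (c *: x).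
Proof.
elim=> [|d z t Pz _ IHt]; first by rewrite scaler0; apply: lspan0.
by rewrite scalerDr scalerA; apply: lspan_cons.
Qed.

Lemma lspan_gen P x : P x -> lspan P x.
Proof.
move=> Px; rewrite -[x]scale1r -[_ *: x]addr0.
by apply: lspan_cons => //; apply: lspan0.
Qed.

End LinearSpan.

Lemma lspan_map (V W : lmodType Qq) (f : V -> W) P (Q : W -> Prop) x :
  (forall c z t, f (c *: z + t) = c *: f z + f t) ->
  (forall z, P z -> lspan Q (f z)) -> lspan P x -> lspan Q (f x).
Proof.
move=> fL PQ; elim=> [|c z t Pz _ IHt].
  have -> : f 0 = 0; last exact: lspan0.
  by have := fL (-1) 0 0; rewrite scaler0 addr0 scaleN1r addNr.
by rewrite fL; apply: lspanD => //; apply/lspanZ/PQ.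
Qed.

(** * Straightening words in the Serre generators *)

Section SerreGenerators.
Variables (A : algType Qq) (F : nat -> A).
Hypothesis Fcomm : forall i j, (i.+1 < j)%N -> F i * F j = F j * F i.
Hypothesis Fserre_up : forall i, serre (F i) (F i.+1).
Hypothesis Fserre_down : forall i, serre (F i.+1) (F i).

(** The subalgebra generated by the first [l] letters, built so that induction peels off the
    leftmost letter. *)
Inductive gen (l : nat) : A -> Prop :=
| gen1 : gen l 1
| gen_F i x of (i < l)%N & gen l x : gen l (F i * x)
| gen_lin c x y of gen l x & gen l y : gen l (c *: x + y).

Lemma gen0 l : gen l 0.
Proof.
by have := gen_lin (-1) (gen1 l) (gen1 l); rewrite scaleN1r addNr.
Qed.

Lemma genZ l c x : gen l x -> gen l (c *: x).
Proof. by move=> gx; rewrite -[_ *: x]addr0; apply: gen_lin (gen0 l). Qed.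

Lemma genM l x y : gen l x -> gen l y -> gen l (x * y).
Proof.
move=> gx gy; elim: gx => [|i z il _ IH|c z t _ IHz _ IHt].
- by rewrite mul1r.
- by rewrite -mulrA; apply: gen_F.
- by rewrite mulrDl -scalerAl; apply: gen_lin.
Qed.

Lemma gen_exp l i r : (i < l)%N -> gen l (F i ^+ r).
Proof.
by move=> il; elim: r => [|r IH]; [apply: gen1 | rewrite exprS; apply: gen_F].
Qed.

Lemma gen_widen l l' x : (l <= l')%N -> gen l x -> gen l' x.
Proof.
move=> ll; elim=> [|i z il _ IH|c z t _ IHz _ IHt]; [exact: gen1| |exact: gen_lin].
by apply: gen_F => //; apply: leq_trans il ll.
Qed.

Lemma gen_zero x : gen 0 x -> exists c : Qq, x = c *: 1.
Proof.
elim=> [|i z //|c z t _ [d ->] _ [e ->]]; first by exists 1; rewrite scale1r.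
by exists (c * d + e); rewrite scalerDl scalerA.
Qed.

Lemma gen_comm l x : gen l x -> F l.+1 * x = x * F l.+1.
Proof.
elim=> [|i z il _ IH|c z t _ IHz _ IHt].
- by rewrite mul1r mulr1.
- by rewrite mulrA -Fcomm // -mulrA IH mulrA.
- by rewrite mulrDr mulrDl -scalerAl -scalerAr IHz IHt.
Qed.

Lemma gen_comm_exp l x j : gen l x -> F l.+1 ^+ j * x = x * F l.+1 ^+ j.
Proof.
move=> gx; elim: j => [|j IH]; first by rewrite mul1r mulr1.
by rewrite exprS -mulrA IH mulrA gen_comm // mulrA.
Qed.

Definition triple_product (l : nat) (z : A) : Prop :=
  exists j x1 x2, [/\ gen l x1, gen l x2 & z = x1 * F l ^+ j * x2].

Lemma lspan_triple_mull l x z : gen l x ->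
  lspan (triple_product l) z -> lspan (triple_product l) (x * z).
Proof.
move=> gx; apply: lspan_map => [c y1 y2|y [j [x1 [x2 [g1 g2 ->]]]]].
  by rewrite mulrDr scalerAr.
by apply: lspan_gen; exists j, (x * x1), x2; split=> //; [apply: genM|rewrite !mulrA].
Qed.

Lemma lspan_triple_mulr l x z : gen l x ->
  lspan (triple_product l) z -> lspan (triple_product l) (z * x).
Proof.
move=> gx; apply: (lspan_map (f := fun z => z * x)) => [c y1 y2|y [j [x1 [x2 [g1 g2 ->]]]]].
  by rewrite mulrDl scalerAl.
by apply: lspan_gen; exists j, x1, (x2 * x); split=> //; [apply: genM|rewrite !mulrA].
Qed.

(** Double induction, on the rank and on the word: it suffices to absorb a top letter multiplied on
    the left of a triple product, and the lower rank reduces this to a computation with two adjacent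
    letters. *)
Lemma gen_triple_product l x : gen l.+1 x -> lspan (triple_product l) x.
Proof.
elim: l x => [|l IHl] x; elim=> {x} [|i x il _ IHx|c x y _ IHx _ IHy];
  try by apply: lspanD => //; apply: lspanZ.
- by apply: lspan_gen; exists 0%N, 1, 1; rewrite !mulr1; split=> //; apply: gen1.
(* In the lowest rank the only letter is [F 0], and [x1] is a scalar. *)
- case: i il => // _; move: IHx; apply: lspan_map => [c y1 y2|y].
    by rewrite mulrDr scalerAr.
  case=> j [x1 [x2 [/gen_zero [c ->] g2 ->]]].
  rewrite -!scalerAl mul1r -scalerAr mulrA -exprS; apply: lspanZ.
  apply: lspan_gen; exists j.+1, 1, x2; rewrite mul1r; split=> //; exact: gen1.
- by apply: lspan_gen; exists 0%N, 1, 1; rewrite !mulr1; split=> //; apply: gen1.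
have [il'|li] := ltnP i l.+1.
  by apply: lspan_triple_mull => //; rewrite -[F i]mulr1; apply: gen_F => //; apply: gen1.
have -> : i = l.+1 by apply/eqP; rewrite eqn_leq li -ltnS il.
move: IHx; apply: lspan_map => [c y1 y2|y]; first by rewrite mulrDr scalerAr.
case=> j [x1 [x2 [g1 g2 ->]]].
(* The left factor [x1] is itself straightened, one rank lower. *)
move/IHl: g1; apply: (lspan_map (f := fun x1 => F l.+1 * (x1 * F l.+1 ^+ j * x2))).
  by move=> c y1 y2; rewrite !mulrDl mulrDr -!scalerAl -scalerAr.
move=> z [r [y1 [y2 [h1 h2 ->]]]].
(* [F l.+1] commutes with [y1] and [y2], which only involve letters below [F l]; what remains is a
   word in [F l] and [F l.+1]. *)
have -> : F l.+1 * (y1 * F l ^+ r * y2 * F l.+1 ^+ j * x2) =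
    y1 * (F l.+1 * F l ^+ r * F l.+1 ^+ j) * (y2 * x2).
  rewrite -!mulrA mulrA gen_comm // -mulrA; congr (_ * (_ * (_ * _))).
  by rewrite [y2 * _]mulrA -gen_comm_exp // -mulrA.
apply: lspan_triple_mulr; first by apply: genM => //; apply: gen_widen h2.
apply: lspan_triple_mull; first by apply: gen_widen h1.
have gF s : gen l.+1 (F l ^+ s) by apply: gen_exp.
case: r => [|r].
  rewrite expr0 mulr1 -exprS; apply: lspan_gen; exists j.+1, 1, 1.
  by rewrite mulr1 mul1r; split=> //; apply: gen1.
(* All but at most one [F l] move to the left of the first [F l.+1]. *)
have [al [be ->]] := serre_move_right r (Fserre_up l).
rewrite mulrDl -!scalerAl; apply: lspanD; apply: lspanZ.
  rewrite -mulrA -exprS; apply: lspan_gen; exists j.+1, (F l ^+ r.+1), 1.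
  by rewrite mulr1; split=> //; apply: gen1.
rewrite -mulrA; apply: lspan_triple_mull => //.
(* The last [F l] caught between powers of [F l.+1] is freed by solving [serre_expand_left]. *)
have -> : F l.+1 * F l * F l.+1 ^+ j = (qint j.+1)^-1 *:
    (F l.+1 ^+ j.+1 * F l + qint j *: (F l * F l.+1 ^+ j.+1)).
  rewrite serre_expand_left // subrK scalerA mulVf; first by rewrite scale1r.
  exact: qintS_neq0.
apply/lspanZ/lspanD.
  apply: lspan_gen; exists j.+1, 1, (F l); rewrite mul1r; split=> //; first exact: gen1.
  by rewrite -[F l]expr1.
apply/lspanZ/lspan_gen; exists j.+1, (F l), 1; rewrite mulr1; split=> //; last exact: gen1.
by rewrite -[F l]expr1.
Qed.

End SerreGenerators.

(** * Representations *)

Section Action.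
Variables (k : nat) (V : vectType Qq) (rho : Urep k V).
Implicit Types (x y : Uq k) (v z : V).

Lemma actD x y v : rho (x + y) v = rho x v + rho y v.
Proof. by rewrite -{1}[x]scale1r act_linear lfunE /= lfunE /= scale1r. Qed.

Lemma act0 v : rho 0 v = 0.
Proof. by apply: (addrI (rho 0 v)); rewrite -actD !addr0. Qed.

Lemma actZ c x v : rho (c *: x) v = c *: rho x v.
Proof. by rewrite -[c *: x]addr0 act_linear lfunE /= lfunE /= act0 addr0. Qed.

Lemma actB x y v : rho (x - y) v = rho x v - rho y v.
Proof. by rewrite actD -scaleN1r actZ scaleN1r. Qed.

Lemma act_mul x y v : rho (x * y) v = rho x (rho y v).
Proof. by rewrite actM lfunE. Qed.

Lemma act_one v : rho 1 v = v.
Proof. by rewrite act1 lfunE. Qed.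

Lemma act_scalar c v : rho c%:A v = c *: v.
Proof. by rewrite actZ act_one. Qed.

Lemma act_UKf h i z :
  rho (UK h) (rho (Uf i) z) = q ^ (- pair (alpha i) h) *: rho (Uf i) (rho (UK h) z).
Proof.
rewrite -actZ -UKf -!act_mul; congr (rho _ z).
by rewrite -!mulrA UKD addNr UK0 mulr1.
Qed.

Lemma act_ef i j z :
  rho (Ue i) (rho (Uf j) z) = rho (Uf j) (rho (Ue i) z) +
    (i == j)%:R *: rho (qbracket (UK (coroot i)) (UK (- coroot i)) 0) z.
Proof.
rewrite -!act_mul -actZ -Uef actB addrC subrK //.
Qed.

Lemma act_qbracket h z (t : int) :
  rho (UK h) z = q ^ t *: z ->
  rho (qbracket (UK h) (UK (- h)) 0) z = ((q - q^-1)^-1 * (q ^ t - q ^ (- t))) *: z.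
Proof.
move=> e; have eN : rho (UK (- h)) z = q ^ (- t) *: z.
  apply: (scalerI (expfz_neq0 t q_neq0)).
  rewrite -linearZ /= -e -act_mul UKD addNr UK0 act_one scalerA -expfzDr ?q_neq0 //.
  by rewrite subrr expr0z scale1r.
rewrite /qbracket oppr0 expr0z !scale1r actZ actB e eN -scalerBl scalerA //.
Qed.

Lemma act_Uf_exp h i j z :
  rho (UK h) (rho (Uf i ^+ j) z) =
    q ^ (- (pair (alpha i) h *+ j)) *: rho (Uf i ^+ j) (rho (UK h) z).
Proof.
elim: j => [|j IHj]; first by rewrite mulr0n oppr0 expr0z scale1r !act_one.
rewrite exprS !act_mul act_UKf IHj linearZ /= scalerA -expfzDr ?q_neq0 //.
by rewrite mulrS opprD.
Qed.

(** One [y] is moved through [x ^+ j.+1]. The term ending in [y] kills [z]; the other acts through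
    [rho (y * x) z], which [y] kills again by the Serre relation, so the induction hypothesis
    applies to that vector. *)
Lemma serre_annihilate x y z j : serre x y -> serre y x -> rho y z = 0 ->
  rho (y ^+ j.+1 * x ^+ j) z = 0.
Proof.
move=> sxy syx; elim: j z => [|j IHj] z yz0; first by rewrite mulr1.
have [al [be e]] := serre_move_right j sxy.
rewrite [y ^+ j.+2]exprSr -mulrA e act_mul actD !actZ [rho (_ * y) z]act_mul yz0.
rewrite linear0 scaler0 add0r linearZ /= act_mul -act_mul IHj ?scaler0 //.
have h1 : rho (y * x * y) z = 0 by rewrite act_mul yz0 linear0.
have h2 : rho (x * y ^+ 2) z = 0 by rewrite expr2 mulrA act_mul yz0 linear0.
have := congr1 (fun u => rho u z) syx.
by rewrite actD actB actZ h1 h2 act0 scaler0 subr0 addr0 expr2 -mulrA act_mul.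
Qed.

(** On a vector killed by [y], the excess power of [x] can be brought to the left, which makes the
    two exponents equal. *)
Lemma serre_exchange x y z j t : serre x y -> serre y x -> rho y z = 0 ->
  exists c, rho (y ^+ j * x ^+ t) z = c *: rho (x ^+ (t - j) * (y ^+ j * x ^+ j)) z.
Proof.
move=> sxy syx yz0; have yj0 i : rho (y ^+ i.+1) (rho (x ^+ i) z) = 0.
  by rewrite -act_mul serre_annihilate.
(* For [t < j] the left side vanishes by [serre_annihilate], so the truncated [t - j] is
   harmless. *)
have [ltj|letj] := ltnP t j.
  exists 0; rewrite scale0r -(subnK ltj) exprD !act_mul yj0 linear0 //.
elim: j letj => [|j IHj] ltj.
  by exists 1; rewrite subn0 scale1r !mul1r !mulr1.
have [c e] := IHj (ltnW ltj).
have [s ets] : {s | t = (s.+1 + j)%N} by exists (t - j.+1)%N; rewrite addSnnS subnK.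
rewrite ets in e *; rewrite addnK in e; rewrite subSS addnK.
have [al [be e']] := serre_move_right s sxy.
rewrite exprS -mulrA act_mul e linearZ /= -act_mul mulrA e' mulrDl -!scalerAl.
rewrite actD !actZ !act_mul -[rho y _]act_mul -exprS yj0 linear0 scaler0 add0r.
have e2 : y * x * y ^+ j = (qint j.+1)^-1 *:
    (y ^+ j.+1 * x + qint j *: (x * y ^+ j.+1)).
  rewrite serre_expand_left // subrK scalerA mulVf; first by rewrite scale1r.
  exact: qintS_neq0.
exists (c * (be * (qint j.+1)^-1)).
rewrite -!scalerA; congr (_ *: (_ *: _)).
rewrite -linearZ /=; congr (rho _ _).
have e3 u : rho y (rho x (rho (y ^+ j) u)) = (qint j.+1)^-1 *:
    (rho (y ^+ j.+1) (rho x u) + qint j *: rho x (rho (y ^+ j.+1) u)).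
  by rewrite -!act_mul e2 actZ actD actZ.
rewrite e3 yj0 linear0 scaler0 addr0.
by rewrite exprS act_mul [in RHS]exprS [in RHS]act_mul.
Qed.

End Action.

(** * Spanning by lowering operators *)

Section Lowering.
Variable k : nat.

(* Padding by 0 keeps all relations and avoids ordinals in inductions on the  *)
(* rank.                                                                      *)
Definition Fn (i : nat) : Uq k :=
  if insub i is Some i' then Uf (i' : 'I_k.-1) else 0.

Lemma FnE (i : 'I_k.-1) : Fn i = Uf i.
Proof. by rewrite /Fn valK. Qed.

Lemma Fn_cases (i : nat) : (exists2 i' : 'I_k.-1, i = i' :> nat & Fn i = Uf i') \/ Fn i = 0.
Proof.
by rewrite /Fn; case: insubP => [i' _ <-|_]; [left; exists i' | right].
Qed.

Lemma Fn_comm i j : (i.+1 < j)%N -> Fn i * Fn j = Fn j * Fn i.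
Proof.
have [[i' -> ->]|->] := Fn_cases i; last by rewrite mul0r mulr0.
have [[j' -> ->]|->] := Fn_cases j; last by rewrite mul0r mulr0.
by move=> ij; apply: Ucomm_f; rewrite ij.
Qed.

Lemma Fn_serre_up i : serre (Fn i) (Fn i.+1).
Proof.
have [[i' ei ->]|->] := Fn_cases i; last exact: serre0l.
have [[j' ej ->]|->] := Fn_cases i.+1; last exact: serre0r.
by apply: Userre_f; rewrite -ei -ej eqxx.
Qed.

Lemma Fn_serre_down i : serre (Fn i.+1) (Fn i).
Proof.
have [[i' ei ->]|->] := Fn_cases i; last exact: serre0r.
have [[j' ej ->]|->] := Fn_cases i.+1; last exact: serre0l.
by apply: Userre_f; rewrite -ei -ej eqxx orbT.
Qed.

Variables (V : vectType Qq) (rho : Urep k V) (v : V) (a : nat).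
Hypothesis Fv0 : forall i, i != a -> rho (Fn i) v = 0.

(** The vector [v_j] with ordinary instead of divided powers, truncated after [d] letters; here [a]
    is the 0-based node. *)
Fixpoint chain (d j : nat) : V :=
  if d is d'.+1 then rho (Fn (a + d') ^+ j) (chain d' j) else v.

Lemma gen_chain d j : exists2 y, gen Fn (a + d) y & chain d j = rho y v.
Proof.
elim: d => [|d [y gy e]]; first by exists 1; [apply: gen1|rewrite act_one].
exists (Fn (a + d) ^+ j * y); last by rewrite /= e act_mul.
by rewrite addnS; apply: genM; [apply: gen_exp|apply: gen_widen gy].
Qed.

(** [F (a + d)] is skipped: the letter [Fn (a + d).+1] commutes with all letters of the chain and so
    reaches [v], which it kills. *)
Lemma chain_next0 d j : rho (Fn (a + d).+1) (chain d j) = 0.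
Proof.
have [y gy ->] := gen_chain d j; rewrite -act_mul (gen_comm Fn_comm gy) act_mul.
by rewrite Fv0 ?linear0 // eqn_leq -addnS -{2}[a]addn0 leq_add2l.
Qed.

(** The exponent of the new outermost letter is imposed on the whole chain. By [serre_exchange] the
    previous letter gets exponent [j], and the induction hypothesis propagates this down to [v]. *)
Lemma chain_exchange d j j' : exists2 y, gen Fn (a + d) y &
  rho (Fn (a + d) ^+ j) (chain d j') = rho y (chain d.+1 j).
Proof.
elim: d j' => [|d IHd] j'; first by exists 1; [apply: gen1|rewrite act_one].
have [y gy e] := IHd j'.
have [c ec] := serre_exchange j j' (Fn_serre_up (a + d)) (Fn_serre_down _)
  (chain_next0 d j').
exists (c *: (Fn (a + d) ^+ (j' - j) * y)).
  by rewrite addnS; apply/genZ/genM; [apply: gen_exp|apply: gen_widen gy].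
rewrite addnS /= -act_mul ec actZ !act_mul e /=; congr (_ *: rho _ _).
by rewrite -act_mul (gen_comm_exp Fn_comm _ gy) act_mul addnS.
Qed.

Lemma gen_below_highest x : gen Fn a x -> exists c, rho x v = c *: v.
Proof.
elim=> [|i z ia _ [c e]|c y z _ [d e] _ [d' e']].
- by exists 1; rewrite act_one scale1r.
- by exists 0; rewrite act_mul e linearZ /= Fv0 ?scaler0 ?scale0r // ltn_eqF.
- by exists (c * d + d'); rewrite actD actZ e e' scalerDl scalerA.
Qed.

Definition lowered_chain (d : nat) (z : V) : Prop :=
  exists j y, gen Fn (a + d) y /\ z = rho y (chain d.+1 j).

(** In a triple product, the right factor applied to [v] is treated one rank lower; then
    [chain_exchange] absorbs the power of the top letter into the chain. *)
Lemma gen_lowered_chain d x : gen Fn (a + d).+1 x ->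
  lspan (lowered_chain d) (rho x v).
Proof.
elim: d x => [|d IHd] x /(gen_triple_product Fn_comm Fn_serre_up Fn_serre_down);
  apply: (lspan_map (f := fun x => rho x v)); try by move=> c y z; rewrite actD actZ.
all: move=> y [j [x1 [x2 [g1 g2 ->]]]].
  rewrite addn0 in g1 g2 *; have [c e] := gen_below_highest g2.
  rewrite act_mul e linearZ /=; apply/lspanZ/lspan_gen; exists j, x1.
  by rewrite act_mul /= addn0.
rewrite addnS in g1 g2 *; rewrite act_mul; move: (IHd _ g2).
apply: (lspan_map (f := fun z => rho (x1 * Fn (a + d).+1 ^+ j) z)) => [c y1 y2|z].
  by rewrite linearP.
(* The top letter commutes with [y1] and so meets the chain directly. *)
case=> j' [y1 [gy1 ->]]; rewrite -act_mul -mulrA (gen_comm_exp Fn_comm _ gy1).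
have [y2] := chain_exchange d.+1 j j'; rewrite addnS => gy2 e.
rewrite !act_mul e; apply: lspan_gen; exists j, (x1 * y1 * y2); split.
  rewrite addnS; apply: genM => //; apply: genM => //.
  by apply: gen_widen gy1.
by rewrite !act_mul.
Qed.

End Lowering.

(** * Highest weight representations and contravariant forms *)

Lemma Uq_ind k (P : Uq k -> Prop) :
  (forall c, P c%:A) -> (forall i, P (Ue i)) -> (forall i, P (Uf i)) ->
  (forall h, P (UK h)) -> (forall x y, P x -> P y -> P (x + y)) ->
  (forall x y, P x -> P y -> P (x * y)) -> forall x, P x.
Proof.
move=> Pc Pe Pf PK PD PM; elim/quotW => x.
elim: x => [c|i|i|h|x Px y Py|x Px y Py]; rewrite ?piUE.
- exact: Pc.
- exact: Pe.
- exact: Pf.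
- exact: PK.
- exact: PD.
- exact: PM.
Qed.

(** Among the subspaces contained in [P], one of maximal dimension contains every vector of [P],
    since otherwise adding a line would enlarge it. *)
Lemma vspace_of_pred (V : vectType Qq) (P : V -> Prop) :
  P 0 -> (forall c x y, P x -> P y -> P (c *: x + y)) ->
  exists W : {vspace V}, forall x, x \in W <-> P x.
Proof.
move=> P0 PL.
pose inP (n : nat) := `[< exists2 W : {vspace V}, \dim W = n & forall x, x \in W -> P x >].
have ex0 : exists n, inP n.
  exists 0%N; apply/asboolP; exists 0%VS; first exact: dimv0.
  by move=> x; rewrite memv0 => /eqP ->.
have ub n : inP n -> (n <= \dim {:V})%N.
  by case/asboolP => W <- _; apply: dimvS (subvf W).
case: (ex_maxnP ex0 ub) => n /asboolP[W dW WP] maxn; exists W => x.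
split=> [/WP //|Px]; apply: contraT => xW.
suff /maxn : inP n.+1 by rewrite ltnn.
apply/asboolP; exists (W + <[x]>)%VS.
  rewrite dimv_disjoint_sum; last first.
    apply/eqP; rewrite -subv0; apply/subvP => y /memv_capP[yW /vlineP[c ey]].
    rewrite memv0 ey; have [->|c0] := eqVneq c 0; first by rewrite scale0r.
    case/negP: xW; rewrite -[x]scale1r -(mulVf c0) -scalerA -ey.
    exact: memvZ.
  rewrite dW dim_vline (_ : x != 0) ?addn1 //.
  by apply: contraNneq xW => ->; apply: mem0v.
move=> y /memv_addP[y1 /WP Py1 [y2 /vlineP[c ->] ->]].
by rewrite addrC; apply: PL.
Qed.

Section HighestWeight.
Variables (k : nat) (lam : weight k) (M : hwrep lam).
Local Notation rho := (hw_act M).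
Local Notation v := (hw_vec M).

(** Irreducibility as an induction principle: [P] cuts out a nonzero subrepresentation. *)
Lemma hwrep_simple (P : M -> Prop) :
  (forall c x y, P x -> P y -> P (c *: x + y)) ->
  (forall i x, P x -> P (rho (Ue i) x)) -> (forall i x, P x -> P (rho (Uf i) x)) ->
  (forall h x, P x -> P (rho (UK h) x)) ->
  (exists2 x, x != 0 & P x) -> forall x, P x.
Proof.
move=> PL Pe Pf PK [x0 x0n Px0].
have P0 : P 0 by have := PL (-1) _ _ Px0 Px0; rewrite scaleN1r addNr.
have PZ c x : P x -> P (c *: x) by move=> Px; rewrite -[_ *: x]addr0; apply: PL.
have PU x : forall y, P y -> P (rho x y).
  elim/Uq_ind: x => [c|i|i|h|x1 x2 IH1 IH2|x1 x2 IH1 IH2] y Py.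
  - by rewrite act_scalar; apply: PZ.
  - exact: Pe.
  - exact: Pf.
  - exact: PK.
  - by rewrite actD -[rho x1 y]scale1r; apply: PL; [apply: IH1|apply: IH2].
  - by rewrite act_mul; apply/IH1/IH2.
have [W WP] := vspace_of_pred P0 PL.
have [_ /(_ W)] := hw_irreducible M; case.
- move=> x; apply/subvP => y /memv_imgP[z /WP Pz ->].
  by apply/WP/PU.
- by move=> W0; move/WP: Px0; rewrite W0 memv0 (negPf x0n).
- by move=> WT x; apply/WP; rewrite WT memvf.
Qed.

Inductive lowering_word : M -> Prop :=
| lw_nil : lowering_word v
| lw_cons i x of lowering_word x : lowering_word (rho (Uf i) x).

Lemma lowering_word_weight x : lowering_word x ->
  forall h, exists t : int, rho (UK h) x = q ^ t *: x.
Proof.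
elim=> [|i y _ IH] h; first by exists (pair lam h); apply: hw_vec_weight.
have [t e] := IH h; exists (- pair (alpha i) h + t).
by rewrite act_UKf e linearZ /= scalerA expfzDr ?q_neq0.
Qed.

(** The words in the [Uf i] applied to the highest weight vector span a subrepresentation, hence
    everything. *)
Lemma hwrep_ind (P : M -> Prop) :
  (forall c x y, P x -> P y -> P (c *: x + y)) -> P v ->
  (forall i x, P x -> P (rho (Uf i) x)) -> forall x, P x.
Proof.
move=> PL Pv Pf x.
have P0 : P 0 by have := PL (-1) _ _ Pv Pv; rewrite scaleN1r addNr.
suff: lspan lowering_word x.
  elim=> [//|c y z wy _ Pz]; apply: PL => //; elim: wy => // i t _; exact: Pf.
have fS i y : lspan lowering_word y -> lspan lowering_word (rho (Uf i) y).
  apply: lspan_map => [c z t|z wz]; first by rewrite linearP.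
  by apply/lspan_gen/lw_cons.
apply: (hwrep_simple (P := lspan lowering_word)).
- by move=> c y z Sy Sz; apply: lspanD => //; apply: lspanZ.
(* Commuting [Ue i] past a letter leaves a Cartan term, which acts on the rest of the word by a
   scalar. *)
- move=> i y; apply: lspan_map => [c z t|z]; first by rewrite linearP.
  elim=> [|j t wt IHt]; first by rewrite hw_vec_e; apply: lspan0.
  have [s e] := lowering_word_weight wt (coroot i).
  rewrite act_ef (act_qbracket e); apply: lspanD; first exact: fS.
  by do 2!apply: lspanZ; apply: lspan_gen.
- exact: fS.
- move=> h y; apply: lspan_map => [c z t|z wz]; first by rewrite linearP.
  by have [t ->] := lowering_word_weight wz h; apply/lspanZ/lspan_gen.
- by exists v; [apply: hw_vec_neq0|apply/lspan_gen/lw_nil].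
Qed.

End HighestWeight.

Lemma pair_coroot k (mu : weight k) i : pair mu (coroot i) = mu 0 i.
Proof.
rewrite /pair (bigD1 i) //= mxE !eqxx mulr1 big1 ?addr0 // => j ji.
by rewrite mxE (negPf ji) andbF mulr0.
Qed.

(** Entries of the Cartan matrix of type A. *)
Lemma alphaE k (i j : 'I_k.-1) :
  alpha i 0 j = (i == j :> nat)%:R *+ 2 - (i == j.+1 :> nat)%:R - (i.+1 == j :> nat)%:R.
Proof.
by rewrite !mxE !eqSS mulr2n opprB; ring.
Qed.

(** The Shapovalov axioms without the normalization, so that they also cover forms pulled back from
    a larger representation. *)
Definition contravariant k (V : vectType Qq) (rho : Urep k V)
    (form : V -> V -> Qq) : Prop :=
  [/\ forall x y, form x y = form y x,
      forall c x x' y, form (c *: x + x') y = c * form x y + form x' y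
    & forall p x y, form (rho p x) y = form x (rho (anti p) y)].

Section BilinearForm.
Variables (k : nat) (V : vectType Qq) (rho : Urep k V) (form : V -> V -> Qq).
Hypothesis fP : contravariant rho form.

Lemma contravariantC x y : form x y = form y x. Proof. by case: fP. Qed.
Lemma contravariant_act p x y : form (rho p x) y = form x (rho (anti p) y).
Proof. by case: fP. Qed.
Lemma contravariant_lin c x x' y : form (c *: x + x') y = c * form x y + form x' y.
Proof. by case: fP. Qed.

Lemma contravariant0 y : form 0 y = 0.
Proof.
have := contravariant_lin (-1) 0 0 y; rewrite scaler0 addr0 mulN1r addNr //.
Qed.

Lemma contravariantZ c x y : form (c *: x) y = c * form x y.
Proof. by rewrite -[c *: x]addr0 contravariant_lin contravariant0 addr0. Qed.

Lemma contravariantZr c x y : form x (c *: y) = c * form x y.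
Proof. by rewrite contravariantC contravariantZ contravariantC. Qed.

Lemma contravariantB x y z : form (x - y) z = form x z - form y z.
Proof. by rewrite addrC -scaleN1r contravariant_lin mulN1r addrC. Qed.

End BilinearForm.

Section ContravariantForm.
Variables (k : nat) (lam : weight k) (M : hwrep lam).
Local Notation rho := (hw_act M).
Local Notation v := (hw_vec M).

(** Every vector is a combination of [v] and of vectors [Uf i y], and the form moves [Uf i] to
    [Ue i] acting on [x]. *)
Lemma singular_pairing (form : M -> M -> Qq) (x : M) :
  contravariant rho form -> (forall i, rho (Ue i) x = 0) -> form x v = 0 ->
  forall y, form x y = 0.
Proof.
move=> fP xe xv y; rewrite (contravariantC fP).
elim/hwrep_ind: y => [c y z Py Pz||i y _].
- by rewrite (contravariant_lin fP) Py Pz mulr0 addr0.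
- by rewrite (contravariantC fP).
- rewrite (contravariant_act fP) anti_f xe (contravariantC fP).
  exact: contravariant0 fP _.
Qed.

Lemma contravariant_eq0 (form : M -> M -> Qq) :
  contravariant rho form -> form v v = 0 -> forall x y, form x y = 0.
Proof.
move=> fP fvv; have vy := singular_pairing fP (@hw_vec_e _ _ M) fvv.
elim/hwrep_ind=> [c x z Px Pz y|//|i x Px y].
  by rewrite (contravariant_lin fP) Px Pz mulr0 addr0.
by rewrite (contravariant_act fP) Px.
Qed.

Variable form : M -> M -> Qq.
Hypothesis formP : shapovalov rho v form.

Lemma shapovalov_contravariant : contravariant rho form.
Proof. by case: formP. Qed.
Let fP := shapovalov_contravariant.

(** The difference of the two sides is contravariant and vanishes at the highest weight vector, so
    [contravariant_eq0] applies. *)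
Lemma contravariant_unique (g : M -> M -> Qq) : contravariant rho g ->
  forall x y, g x y = g v v * form x y.
Proof.
move=> gP x y; apply/eqP; rewrite -subr_eq0; apply/eqP.
pose h x y := g x y - g v v * form x y.
rewrite -/(h x y); apply: contravariant_eq0.
  split=> [z t|c z z' t|p z t]; rewrite /h.
  - by rewrite (contravariantC gP) (contravariantC fP).
  - by rewrite (contravariant_lin gP) (contravariant_lin fP) mulrDr mulrCA opprD addrACA -mulrBr.
  - by rewrite (contravariant_act gP) (contravariant_act fP).
by rewrite /h; case: formP => _ _ -> _; rewrite mulr1 subrr.
Qed.

(** The radical is a subrepresentation that does not contain the highest weight vector. *)
Lemma shapovalov_nondegenerate x : (forall y, form x y = 0) -> x = 0.
Proof.
move=> xrad; apply: contrapT => /eqP xn0.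
suff rad z : forall y, form z y = 0.
  by case: formP => _ _ vv1 _; have := rad v v; rewrite vv1; apply/eqP/oner_neq0.
have sub p z' : (forall y, form z' y = 0) -> forall y, form (rho p z') y = 0.
  by move=> Pz y; rewrite (contravariant_act fP).
apply: (hwrep_simple (P := fun z => forall y, form z y = 0)); last by exists x.
- by move=> c y z' Py Pz' t; rewrite (contravariant_lin fP) Py Pz' mulr0 addr0.
- by move=> i z'; apply: sub.
- by move=> i z'; apply: sub.
- by move=> h z'; apply: sub.
Qed.

Lemma singular_eq0 x : (forall i, rho (Ue i) x = 0) -> form x v = 0 -> x = 0.
Proof.
by move=> xe xv; apply: shapovalov_nondegenerate; apply: singular_pairing fP xe xv.
Qed.

Lemma string_weight i r (n : nat) : lam 0 i = n%:Z ->
  rho (UK (coroot i)) (rho (Uf i ^+ r) v) = q ^ (n%:Z - r%:Z *+ 2) *: rho (Uf i ^+ r) v.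
Proof.
move=> ln; elim: r => [|r IHr].
  by rewrite !act_one mul0rn subr0 hw_vec_weight pair_coroot ln.
rewrite exprS act_mul act_UKf IHr linearZ /= scalerA -expfzDr ?q_neq0 //.
congr (q ^ _ *: _); rewrite pair_coroot alphaE eqxx.
rewrite (ltn_eqF (ltnSn i)) (gtn_eqF (ltnSn i)) !subr0 intS -[true%:R]/(1 : int); ring.
Qed.

Lemma string_raise i r (n : nat) : lam 0 i = n%:Z ->
  rho (Ue i) (rho (Uf i ^+ r) v) =
  (\sum_(0 <= s < r) (q - q^-1)^-1 * (q ^ (n%:Z - s%:Z *+ 2) - q ^ (- (n%:Z - s%:Z *+ 2))))
    *: rho (Uf i ^+ r.-1) v.
Proof.
move=> ln; elim: r => [|r IHr]; first by rewrite act_one hw_vec_e big_geq ?scale0r.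
rewrite exprS act_mul act_ef eqxx scale1r (act_qbracket (string_weight r ln)) IHr.
rewrite linearZ /= -act_mul big_nat_recr //= scalerDl; congr (_ + _).
case: r IHr => [|r] _; first by rewrite big_geq // !scale0r.
by rewrite -exprS.
Qed.

(** This vector is singular and orthogonal to [v], hence 0. For [j != i], [Ue j] commutes with
    [Uf i]; for [j = i] the coefficient is the vanishing sum [qbracket_string_sum]. *)
Lemma lowering_string_end i (n : nat) : lam 0 i = n%:Z -> rho (Uf i ^+ n.+1) v = 0.
Proof.
move=> ln; apply: singular_eq0 => [j|]; last first.
  rewrite exprS act_mul (contravariant_act fP) anti_f hw_vec_e.
  by rewrite (contravariantC fP) (contravariant0 fP).
have [<-|ij] := eqVneq i j.
  by rewrite (string_raise _ ln) qbracket_string_sum scale0r.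
elim: n.+1 => [|r IHr]; first by rewrite act_one hw_vec_e.
by rewrite exprS act_mul act_ef IHr linear0 eq_sym (negPf ij) scale0r addr0.
Qed.

End ContravariantForm.

(** * Restriction to rank k-1 *)

Lemma antiD k (x y : Uq k) : anti (x + y) = anti x + anti y.
Proof.
have anti0 : anti (0 : Uq k) = 0 by rewrite -[X in anti X](subrr 0) antiB subrr.
by rewrite -{1}[y]opprK -[- y]sub0r !antiB anti0 sub0r opprK.
Qed.

Lemma bar_scale k c (x : Uq k) : bar (c *: x) = barQ c *: bar x.
Proof. by rewrite -(mulr_algl c x) (rmorphM (@bar k)) /= bar_scal mulr_algl. Qed.

Section InclusionCompatibility.
Variable k : nat.

Lemma incl_scale c (x : Uq k.-1) : incl (c *: x) = c *: incl x.
Proof. by rewrite -(mulr_algl c x) (rmorphM (@incl k)) /= incl_scal mulr_algl. Qed.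

Lemma incl_exp (x : Uq k.-1) n : incl (x ^+ n) = incl x ^+ n.
Proof. exact: (rmorphXn (@incl k)). Qed.

Lemma anti_incl (x : Uq k.-1) : anti (incl x) = incl (anti x).
Proof.
elim/Uq_ind: x => [c|i|i|h|x y IHx IHy|x y IHx IHy].
- by rewrite anti_scal !incl_scal anti_scal.
- by rewrite anti_e incl_e incl_f anti_e.
- by rewrite anti_f incl_e incl_f anti_f.
- by rewrite anti_K !incl_K anti_K.
- by rewrite (rmorphD (@incl k)) !antiD (rmorphD (@incl k)) /= IHx IHy.
- by rewrite (rmorphM (@incl k)) !antiM (rmorphM (@incl k)) /= IHx IHy.
Qed.

Lemma bar_incl (x : Uq k.-1) : bar (incl x) = incl (bar x).
Proof.
elim/Uq_ind: x => [c|i|i|h|x y IHx IHy|x y IHx IHy].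
- by rewrite bar_scal !incl_scal bar_scal.
- by rewrite bar_e incl_e bar_e.
- by rewrite bar_f incl_f bar_f.
- by rewrite bar_K !incl_K bar_K up_coweightN.
- by rewrite (rmorphD (@incl k)) !(rmorphD (@bar _)) (rmorphD (@incl k)) /= IHx IHy.
- by rewrite (rmorphM (@incl k)) !(rmorphM (@bar _)) (rmorphM (@incl k)) /= IHx IHy.
Qed.

Lemma incl_qbracket h n : incl (qbracket (UK h) (UK (- h)) n) =
  qbracket (UK (@up_coweight k h)) (UK (- up_coweight h)) n.
Proof.
by rewrite /qbracket incl_scale (rmorphB (@incl k)) /= !incl_scale !incl_K up_coweightN.
Qed.

Lemma incl_UA (x : Uq k.-1) : UA x -> UA (incl x).
Proof.
elim=> [c Ac|i n n0|i n n0|h|h n n0|y z _ IHy _ IHz|y z _ IHy _ IHz].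
- by rewrite incl_scal; apply: UA_scal.
- by rewrite /ediv incl_scale incl_exp incl_e; apply: UA_e.
- by rewrite /fdiv incl_scale incl_exp incl_f; apply: UA_f.
- by rewrite incl_K; apply: UA_K.
- rewrite /Kdiv incl_scale (rmorph_prod (@incl k)) /=.
  under eq_bigr do rewrite incl_qbracket.
  exact: UA_Kdiv.
- by rewrite (rmorphD (@incl k)); apply: UA_add.
- by rewrite (rmorphM (@incl k)); apply: UA_mul.
Qed.

Lemma UA1 : UA (1 : Uq k).
Proof.
rewrite -[1]scale1r; apply: UA_scal; exists 1, 0%N.
by rewrite (rmorph1 of_poly) expr0 divr1.
Qed.

Lemma UA_fdiv (i : 'I_k.-1) n : UA (fdiv i n).
Proof.
case: n => [|n]; last exact: UA_f.
by rewrite /fdiv /qfact big_geq // invr1 scale1r; apply: UA1.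
Qed.

Lemma bar_fdiv (i : 'I_k.-1) n : bar (fdiv i n) = fdiv i n.
Proof.
by rewrite /fdiv bar_scale (rmorphXn (@bar _)) /= bar_f fmorphV /= barQ_qfact.
Qed.

End InclusionCompatibility.

(** * A grading preserved by the smaller quantum group *)

Section DegreeCoweight.
Variable k : nat.

(* Its torus element commutes with U_q(sl_(k-1)) and separates the v_j.       *)
Definition degree_coweight : coweight k := \row_(i < k.-1) i.+1%:Z.

Lemma sum_delta n (c : nat) (g : nat -> int) :
  \sum_(j < n) (c == j)%:R * g j = if (c < n)%N then g c else 0.
Proof.
case: ltnP => [cn|nc].
  rewrite (bigD1 (Ordinal cn)) //= eqxx mul1r big1 ?addr0 // => j jc.
  by rewrite (_ : (c == j) = false) ?mul0r //; apply: contraNF jc => /eqP cj; apply/eqP/val_inj.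
by rewrite big1 // => j _; rewrite gtn_eqF ?mul0r // (leq_trans (ltn_ord j)).
Qed.

(** The pairing is minus a second difference of the linear sequence 1, 2, 3, ..., hence 0, except at
    the last node, where the right neighbour is missing. *)
Lemma pair_degree_coweight (i : 'I_k.-1) :
  pair (alpha i) degree_coweight = if (i.+1 < k.-1)%N then 0 else k%:Z.
Proof.
rewrite /pair.
transitivity (\sum_(j < k.-1) (i == j :> nat)%:R * (j.+1%:Z *+ 2)
   - \sum_(j < k.-1) (i == j.+1 :> nat)%:R * j.+1%:Z
   - \sum_(j < k.-1) (i.+1 == j :> nat)%:R * j.+1%:Z).
  rewrite -!sumrB; apply: eq_bigr => j _.
  by rewrite alphaE mxE; ring.
rewrite (sum_delta _ _ (fun j => j.+1%:Z *+ 2)) ltn_ord.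
rewrite (sum_delta _ _ (fun j => j.+1%:Z)).
have -> : \sum_(j < k.-1) (i == j.+1 :> nat)%:R * j.+1%:Z = i%:Z.
  case: (nat_of_ord i) (ltn_ord i) => [|i'] il; first by rewrite big1 // => j _; rewrite mul0r.
  under eq_bigr do rewrite eqSS.
  by rewrite (sum_delta _ _ (fun j => j.+1%:Z)) (ltnW il).
have e : i.+1%:Z *+ 2 - i%:Z = i.+2%:Z by rewrite (intS i.+1) (intS i); ring.
rewrite e; case: ltnP => [_|ki]; first by rewrite subrr.
rewrite subr0; congr (_%:Z); have := ltn_ord i; case: k i ki {e} => [[]//|k' i ki il].
by apply/eqP; rewrite eqn_leq ltnS il ltnS ki.
Qed.

Lemma degree_comm_incl (x : Uq k.-1) :
  UK degree_coweight * incl x = incl x * UK degree_coweight.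
Proof.
have pair0 (i : 'I_k.-1.-1) : pair (alpha (up_node i)) degree_coweight = 0.
  rewrite pair_degree_coweight /= (_ : (i.+1 < k.-1)%N) //.
  by have := ltn_ord i; rewrite ltn_predRL.
elim/Uq_ind: x => [c|i|i|h|x y IHx IHy|x y IHx IHy].
- by rewrite incl_scal mulr_algl mulr_algr.
- rewrite incl_e; have := UKe degree_coweight (up_node i); rewrite pair0 expr0z scale1r.
  by move=> {2}<-; rewrite -!mulrA UKD addNr UK0 mulr1.
- rewrite incl_f; have := UKf degree_coweight (up_node i); rewrite pair0 oppr0 expr0z scale1r.
  by move=> {2}<-; rewrite -!mulrA UKD addNr UK0 mulr1.
- by rewrite incl_K !UKD addrC.
- by rewrite (rmorphD (@incl k)) mulrDr mulrDl /= IHx IHy.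
- by rewrite (rmorphM (@incl k)) /= mulrA IHx -mulrA IHy mulrA.
Qed.

End DegreeCoweight.

Lemma gen_incl k (y : Uq k) : gen (Fn k) k.-1.-1 y -> exists p, y = incl p.
Proof.
elim=> [|i x il _ [p ->]|c x z _ [p ->] _ [p' ->]].
- by exists 1; rewrite (rmorph1 (@incl k)).
- exists (Uf (Ordinal il) * p).
  rewrite (rmorphM (@incl k)) /= incl_f -FnE //.
- by exists (c *: p + p'); rewrite (rmorphD (@incl k)) /= incl_scale.
Qed.

(** * Decomposition of the representation under restriction *)

Section RestrictedHighestWeights.
Variables (k a m : nat).
Hypothesis (ha : (1 <= a <= k.-1)%N).
Variables (M : hwrep (omega k a *+ m)) (form : M -> M -> Qq).
Hypothesis formP : shapovalov (hw_act M) (hw_vec M) form.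
Local Notation rho := (hw_act M).
Local Notation v := (hw_vec M).

Lemma rect_weight (i : 'I_k.-1) : (omega k a *+ m) 0 i = (if a == i.+1 then m else 0%N)%:Z.
Proof.
rewrite mulmxnE omegaE; case: eqP => _; last by rewrite mul0rn.
by rewrite -[RHS]natz.
Qed.

Lemma lowering_highest i : i != a.-1 -> rho (Fn k i) v = 0.
Proof.
have [[i' -> ->] ia|->] := Fn_cases k i; last by rewrite act0.
rewrite -[Uf i']expr1; apply: (lowering_string_end formP).
by rewrite rect_weight; case: eqP => // ai; rewrite ai /= eqxx in ia.
Qed.

Lemma lowering_highest_exp j : (m < j)%N -> rho (Fn k a.-1 ^+ j) v = 0.
Proof.
move=> mj; have [[i' e ->]|->] := Fn_cases k a.-1; last first.
  by case: j mj => // j _; rewrite expr0n act0.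
rewrite -(subnK mj) exprD act_mul (lowering_string_end formP) ?linear0 //.
rewrite rect_weight -e prednK ?eqxx //.
by case/andP: ha.
Qed.

(** Each of the [k - a] divided powers contributes a factor [(qfact j)^-1]. *)
Lemma vj_chain j : exists2 c : Qq, c != 0 &
  vj M a j = c *: chain rho v a.-1 (k.-1 - a.-1) j.
Proof.
rewrite /vj; set d := (k.-1 - a.-1)%N.
have [a0 ak] := andP ha.
have kE : k.-1 = (a.-1 + d)%N by rewrite subnKC // -ltnS prednK // leqW.
have -> : \prod_(i <- rev (enum 'I_k.-1) | (a <= i.+1)%N) fdiv i j =
    \prod_(i <- rev (iota 0 k.-1) | (a <= i.+1)%N) ((qfact j)^-1 *: Fn k i ^+ j).
  rewrite -val_enum_ord -map_rev big_map; apply: eq_bigr => i _.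
  by rewrite /fdiv -FnE.
exists ((qfact j)^-1 ^+ d); first by rewrite expf_neq0 // invr_eq0 qfact_neq0.
(* The upper end of the range becomes [a.-1 + d], so induction on [d] adds one letter on the left;
   at [d = 0] the filter leaves no factor. *)
rewrite [X in iota 0 X]kE; elim: d {kE} => [|d IHd].
  rewrite expr0 scale1r addn0 big1_seq ?act_one // => i /andP[ai].
  by rewrite mem_rev mem_iota /= add0n -ltnS prednK // ltnNge ai.
rewrite addnS -[(_ + d).+1]addn1 iotaD rev_cat big_cat /= big_cons big_nil add0n.
have -> : (a <= (a.-1 + d).+1)%N by rewrite -addSn prednK ?leq_addr.
rewrite mulr1 act_mul IHd linearZ /= actZ scalerA.
by rewrite exprSr.
Qed.

(** Only the letter of the last node changes the degree, by [k] for each of its [j] occurrences. *)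
Lemma vj_degree : exists c : int, forall j p,
  rho (UK (degree_coweight k)) (rho (incl p) (vj M a j)) =
    q ^ (c - k%:Z *+ j) *: rho (incl p) (vj M a j).
Proof.
have [a0 ak] := andP ha; exists (pair (omega k a *+ m) (degree_coweight k)) => j p.
rewrite -act_mul degree_comm_incl act_mul -[RHS]linearZ /=; congr (rho _ _).
have [c _ ->] := vj_chain j; rewrite linearZ /= scalerA mulrC -scalerA; congr (_ *: _).
have [n kn] : {n | k.-1 = n.+1} by case: k.-1 ak => [|n]; [case: (a) a0|exists n].
have [d dE] : {d | n = (a.-1 + d)%N}.
  by exists (n - a.-1)%N; rewrite subnKC // -ltnS prednK // -kn.
have -> : (k.-1 - a.-1)%N = d.+1 by rewrite kn dE -addnS addKn.
have low d' : (d' <= d)%N ->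
    rho (UK (degree_coweight k)) (chain rho v a.-1 d' j) =
    q ^ pair (omega k a *+ m) (degree_coweight k) *: chain rho v a.-1 d' j.
  elim: d' => [|d' IHd'] dd; first exact: hw_vec_weight.
  have l1 : ((a.-1 + d').+1 < k.-1)%N by rewrite kn dE ltnS ltn_add2l.
  rewrite /= (FnE (Ordinal (ltnW l1))) act_Uf_exp pair_degree_coweight /= l1.
  by rewrite mul0rn oppr0 expr0z scale1r IHd' ?(ltnW dd) // linearZ.
have l1 : (a.-1 + d < k.-1)%N by rewrite kn dE.
rewrite /= (FnE (Ordinal l1)) act_Uf_exp pair_degree_coweight /=.
have -> : ((a.-1 + d).+1 < k.-1)%N = false by rewrite kn dE ltnn.
by rewrite low // linearZ /= scalerA -expfzDr ?q_neq0 // addrC.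
Qed.

(** [gen_lowered_chain] at the last node: its coefficients involve only the earlier nodes, so they
    come from [Uq k.-1]. *)
Lemma vj_span (x : M) :
  lspan (fun z => exists j p, (j <= m)%N /\ z = rho (incl p) (vj M a j)) x.
Proof.
have [a0 ak] := andP ha.
have [n kn] : {n | k.-1 = n.+1} by case: k.-1 ak => [|n]; [case: (a) a0|exists n].
have [d dE] : {d | n = (a.-1 + d)%N}.
  by exists (n - a.-1)%N; rewrite subnKC // -ltnS prednK // -kn.
have [y gy ->] : exists2 y, gen (Fn k) (a.-1 + d).+1 y & x = rho y v.
  elim/hwrep_ind: x => [c x z [y gy ->] [y' gy' ->]||i x [y gy ->]].
  - by exists (c *: y + y'); [apply: gen_lin|rewrite actD actZ].
  - by exists 1; [apply: gen1|rewrite act_one].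
  - exists (Fn k i * y); last by rewrite FnE act_mul.
    by apply: gen_F => //; rewrite -dE -kn.
move: (gen_lowered_chain lowering_highest gy).
apply: (lspan_map (f := id)) => // z [j [y1 [gy1 ->]]].
(* For [j > m] the innermost power already kills [v]. *)
have [mj|jm] := ltnP m j.
  rewrite (_ : chain _ _ _ _ _ = 0) ?linear0; first exact: lspan0.
  elim: d {dE gy gy1} => [|d IHd] /=; last by rewrite /= in IHd; rewrite IHd linear0.
  by rewrite addn0; apply: lowering_highest_exp.
have [c c0 e] := vj_chain j.
have dE' : (k.-1 - a.-1)%N = d.+1 by rewrite kn dE -addnS addKn.
have -> : chain rho v a.-1 d.+1 j = c^-1 *: vj M a j.
  by rewrite e dE' scalerA mulVf // scale1r.
have [p ->] : exists p, y1 = incl p by apply: gen_incl; rewrite kn dE.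
by rewrite linearZ /=; apply/lspanZ/lspan_gen; exists j, p.
Qed.

End RestrictedHighestWeights.

(** * Global bases *)

Section Lattices.
Variable V : vectType Qq.

Lemma A0_0 : A0 0.
Proof. by exists 0, 1; rewrite hornerC oner_eq0 rmorph0 mul0r. Qed.

Lemma A0_1 : A0 1.
Proof. by exists 1, 1; rewrite hornerC oner_eq0 rmorph1 divr1. Qed.

Lemma A0_sub x y : A0 x -> A0 y -> A0 (x - y).
Proof.
have d0 (d : {poly rat}) : d.[0] != 0 -> of_poly d != 0.
  by move=> dn; rewrite of_poly_eq0; apply: contraNneq dn => ->; rewrite horner0.
move=> [p [d [dn ->]]] [p' [d' [dn' ->]]]; exists (p * d' - p' * d), (d * d').
split; first by rewrite hornerM; apply: mulf_neq0.
by rewrite -mulNr addf_div ?d0 // (rmorphB of_poly) !(rmorphM of_poly) /= mulNr.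
Qed.

Lemma basis_over_mem (S : set Qq) (X : set V) (I : finType) (g : I -> V) i :
  S 0 -> S 1 -> basis_over S X g -> X (g i).
Proof.
move=> S0 S1 [gX _]; apply/gX; exists (fun j => (j == i)%:R).
  by move=> j; case: eqP.
by rewrite (bigD1 i) //= eqxx scale1r big1 ?addr0 // => j /negPf->; rewrite scale0r.
Qed.

Lemma basis_over_A0_sub (L : set V) (I : finType) (g : I -> V) x y :
  basis_over A0 L g -> L x -> L y -> L (x - y).
Proof.
move=> [gL _] /gL[c Ac ->] /gL[d Ad ->]; apply/gL; exists (fun i => c i - d i).
  by move=> i; apply: A0_sub.
by rewrite -sumrB; apply: eq_bigr => i _; rewrite scalerBl.
Qed.

Variable L : set V.
Hypothesis L_sub : forall x y, L x -> L y -> L (x - y).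

Lemma coset_refl x : L x -> coset L x x.
Proof. by move=> Lx; exists 0; rewrite ?scaler0 ?addr0 // -(subrr x); apply: L_sub. Qed.

Lemma coset_eq x y : L y -> coset L x y -> coset L x = coset L y.
Proof.
move=> Ly [z Lz yx]; have L0 : L 0 by rewrite -(subrr y); apply: L_sub.
apply/seteqP; split=> t [w Lw ->].
  by exists (w - z); [apply: L_sub|rewrite yx -addrA -scalerDr [z + _]addrC subrK].
exists (z + w); first by rewrite -[w]opprK -[- w]sub0r; apply/L_sub/L_sub.
by rewrite yx scalerDr addrA.
Qed.

End Lattices.

Lemma lspan_sum (V : lmodType Qq) (P : V -> Prop) (I : finType) (c : I -> Qq) (g : I -> V) :
  (forall i, lspan P (g i)) -> lspan P (\sum_i c i *: g i).
Proof.
move=> Pg; apply: (big_ind (lspan P)) => [|x y|i _]; first exact: lspan0.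
  exact: lspanD.
exact: lspanZ.
Qed.

Section BasedRepresentation.
Variables (k : nat) (lam : weight k) (M : based_rep lam).

Lemma br_L_sub (x y : M) : br_L M x -> br_L M y -> br_L M (x - y).
Proof. by case: (br_lower M) => bG _ _ _; apply: basis_over_A0_sub bG. Qed.

Lemma br_L_G b : br_L M (br_G b).
Proof. by case: (br_lower M) => bG _ _ _; apply: basis_over_mem A0_0 A0_1 bG. Qed.

Lemma br_class_G b : br_class M b (br_G b).
Proof.
by case: (br_lower M) => _ _ <- _; apply: coset_refl (@br_L_sub) _ (br_L_G b).
Qed.

(** The lattice contains a basis of the whole space, and [br_G] spans the lattice. *)
Lemma br_G_span (x : M) : lspan (fun z => exists b : br_B M, z = br_G b) x.
Proof.
case: (br_crystal M) => -[[n [g [gA0 [gT _]]]] _ _ _] _ _ _ _.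
have /gT[c _ ->] : [set: M]%classic x by [].
apply: lspan_sum => i; have := basis_over_mem i A0_0 A0_1 gA0.
case: (br_lower M) => -[GL _] _ _ _ /GL[d _ ->].
by apply: lspan_sum => b; apply: lspan_gen; exists b.
Qed.

Lemma br_contravariant : contravariant (hw_act M) (br_form M).
Proof. exact: shapovalov_contravariant (br_shapovalov M). Qed.

Lemma br_dual b b' : br_form M (br_F M b) (br_G b') = (b == b')%:R.
Proof. by case: (br_upper M). Qed.

Lemma br_G_eq0 b : br_G b <> 0 :> M.
Proof.
move=> G0; have := br_dual b b; rewrite eqxx G0 (contravariantC br_contravariant).
by rewrite (contravariant0 br_contravariant) => /esym/eqP; apply/negP/oner_neq0.
Qed.

Lemma br_G_inj : injective (@br_G _ _ M).
Proof.
move=> b b' e; have := br_dual b b'; rewrite -e br_dual eqxx.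
by case: eqP => // _ /eqP; rewrite (negPf (oner_neq0 _)).
Qed.

Lemma br_F_inj : injective (br_F M).
Proof.
move=> b b' e; have := br_dual b b'; rewrite e br_dual eqxx.
by case: eqP => // _ /eqP; rewrite (negPf (oner_neq0 _)).
Qed.

End BasedRepresentation.

Section RestrictedGlobalBasis.
Variables (k : nat) (lam : weight k) (lam' : weight k.-1).
Variables (M : based_rep lam) (N : based_rep lam') (u0 : Uq k) (phi : 'Hom(N, M)).
Local Notation w := (hw_act M u0 (hw_vec M)).
Hypothesis phi_iso : restriction_iso w phi.

(** The pulled-back form is contravariant because [anti] commutes with [incl]; uniqueness fixes it
    up to its value at the highest weight vector. *)
Lemma restriction_form x y :
  br_form M (phi x) (phi y) = br_form M w w * br_form N x y.
Proof.
case: phi_iso => _ _ phi_act phi_v; have fP := br_contravariant M.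
rewrite -phi_v; apply: (contravariant_unique (br_shapovalov N)
  (g := fun x y => br_form M (phi x) (phi y))); split=> [z t|c z z' t|p z t].
- exact: contravariantC fP _ _.
- by rewrite linearP (contravariant_lin fP).
- by rewrite !phi_act (contravariant_act fP) anti_incl.
Qed.

Hypotheses (u0A : UA u0) (bar_u0 : bar u0 = u0).
Variable phiB : br_B N -> br_B M.
Hypothesis phi_L : forall x, br_L N x -> br_L M (phi x).
Hypothesis phi_B : forall b,
  coset_map (br_L M) phi (br_class N b) = br_class M (phiB b).

(** The image has rational coordinates in the lower global basis, and these can be read off from its
    class modulo q. *)
Lemma restriction_lower b : phi (br_G b) = br_G (phiB b).
Proof.
case: phi_iso => _ _ phi_act phi_v.
case: (br_lower M) => GL GQ Gcls _; case: (br_lower N) => _ G'Q _ G'psi.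
have Q0 : Qsub 0 by exists 0; rewrite rmorph0.
have Q1 : Qsub 1 by exists 1; rewrite rmorph1.
have [[[x Ax /= xG] _] _] := basis_over_mem b Q0 Q1 G'Q.
have phiG : phi (br_G b) = hw_act M (incl x * u0) (hw_vec M).
  by rewrite -xG phi_act phi_v act_mul.
have LG : br_L M (phi (br_G b)) by apply/phi_L/br_L_G.
have psiG : br_psi (phi (br_G b)) = phi (br_G b).
  rewrite {1}phiG (br_bar M) (rmorphM (@bar k)) /= bar_incl bar_u0 act_mul -phi_v -phi_act.
  by rewrite -(br_bar N) xG G'psi.
(* Being bar-invariant and in the lattice, the image also lies in the image of the lattice under
   [br_psi]. *)
have [c cQ eG] : exists2 c : br_B M -> Qq, (forall b', Qsub (c b')) &
    phi (br_G b) = \sum_b' c b' *: br_G b'.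
  apply GQ; split; last by exists (phi (br_G b)).
  by split=> //; exists (incl x * u0); rewrite ?phiG //; apply: UA_mul => //; apply: incl_UA.
have [r rE] : exists r : {ffun br_B M -> rat}, forall b', c b' = of_rat (r b').
  have [r rE] := choice cQ; exists (finfun r) => b'; by rewrite ffunE.
(* Both [r] and the indicator of [phiB b] are coordinates of the class of the image, with the
   [br_G b'] as representatives. *)
case: (br_crystal M) => _ [_ uniq_coord] _ _ _.
have [r0 [_ r0u]] := uniq_coord _ (@br_class_G _ _ M) _ LG.
have e1 : r0 = r.
  by apply: r0u; rewrite eG; congr coset; apply: eq_bigr => b' _; rewrite rE.
have delta : \sum_b' of_rat ([ffun b' => (b' == phiB b)%:R] b') *: br_G b' = br_G (phiB b).
  rewrite (bigD1 (phiB b)) //= ffunE eqxx rmorph1 scale1r big1 ?addr0 // => b' /negPf nb.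
  by rewrite ffunE nb rmorph0 scale0r.
have e2 : r0 = [ffun b' => (b' == phiB b)%:R].
  apply: r0u; rewrite delta; apply/esym/coset_eq => //; first exact: (@br_L_sub _ _ M).
  rewrite Gcls -phi_B; exists (br_G b); first exact: br_class_G.
  exact: coset_refl (@br_L_sub _ _ M) _ LG.
rewrite eG -delta; apply: eq_bigr => b' _.
by rewrite rE -e1 e2.
Qed.

End RestrictedGlobalBasis.

(** * Orthogonality of the summands and passage to dual bases *)

Lemma UA_prod k (I : Type) (r : seq I) (P : pred I) (g : I -> Uq k) :
  (forall i, UA (g i)) -> UA (\prod_(i <- r | P i) g i).
Proof.
by move=> gA; apply: (big_ind (@UA k)) => // [|x y]; [apply: UA1|apply: UA_mul].
Qed.

Theorem theorem4p14 (k a m : nat) (hk : (2 <= k)%N) (ha : (1 <= a <= k.-1)%N)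
  (hm : (0 < m)%N)
  (M : based_rep (omega k a *+ m))
  (N : forall j : 'I_m.+1, based_rep (lamj k a m j))
  (phi : forall j : 'I_m.+1, 'Hom(N j, M))
  (hphi : forall j : 'I_m.+1, restriction_iso (vj M a j) (phi j))
  (phiB : forall j : 'I_m.+1, br_B (N j) -> br_B M)
  (hphiL : forall (j : 'I_m.+1) x, br_L (N j) x -> br_L M (phi j x))
  (hphiB : forall (j : 'I_m.+1) b,
     coset_map (br_L M) (phi j) (br_class (N j) b) = br_class M (phiB j b)) :
  let norm (j : nat) := br_form M (vj M a j) (vj M a j) in
  let FN (j : 'I_m.+1) := [set (norm j)^-1 *: phi j (br_F (N j) b) | b in setT]%classic in
  [/\ range (br_F M) = (\bigcup_(j in setT) FN j)%classic,
      trivIset setT FN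
    & forall (j : 'I_m.+1) (b : br_B (N j)),
        (norm j)^-1 *: phi j (br_F (N j) b) = br_F M (phiB j b)].
Proof.
move=> norm FN.
have fP := br_contravariant M; have sP := br_shapovalov M.
pose u j : Uq k := \prod_(i <- rev (enum 'I_k.-1) | (a <= i.+1)%N) fdiv i j.
have uA j : UA (u j) by apply: UA_prod => i; apply: UA_fdiv.
have ubar j : bar (u j) = u j.
  by rewrite (rmorph_prod (@bar k)); apply: eq_bigr => i _; apply: bar_fdiv.
have phiG j b : phi j (br_G b) = br_G (phiB j b).
  exact: (restriction_lower (hphi j) (uA j) (ubar j) (hphiL j) (hphiB j)).
have phi_form j x y : br_form M (phi j x) (phi j y) = norm j * br_form (N j) x y.
  exact: (restriction_form (hphi j)).
have phi_range j x : exists p, phi j x = hw_act M (incl p) (vj M a j).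
  have [_ rng _ _] := hphi j.
  have : (range (phi j)) (phi j x) by exists x.
  by rewrite rng => -[p _ <-]; exists p.
have [c degE] := vj_degree ha M.
have phi_deg j x : hw_act M (UK (degree_coweight k)) (phi j x) =
    q ^ (c - k%:Z *+ j) *: phi j x.
  by have [p ->] := phi_range j x.
have deg_inj (j j' : 'I_m.+1) :
    q ^ (c - k%:Z *+ j) = q ^ (c - k%:Z *+ j') -> j = j'.
  move/q_expz_inj/addrI/oppr_inj/eqP.
  rewrite -!(mulr_natr k%:Z) !natz -!PoszM eqz_nat eqn_pmul2l; last exact: ltnW hk.
  by move/eqP/val_inj.
(* The torus element is fixed by [anti], hence self-adjoint, and its eigenvalues at [j] and [j']
   differ. *)
have ortho (j j' : 'I_m.+1) x y : j != j' -> br_form M (phi j x) (phi j' y) = 0.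
  move=> jj; apply/eqP; apply: contraNT jj => xy0; apply/eqP/deg_inj.
  apply: (mulIf xy0); rewrite -(contravariantZ fP) -(contravariantZr fP) -!phi_deg.
  by rewrite (contravariant_act fP) anti_K.
have span x : lspan (fun z => exists j b, z = phi j (br_G b)) x.
  apply: (lspan_map (f := id)) (vj_span ha sP x) => // z [j [p [jm ->]]].
  have [_ rng _ _] := hphi (Ordinal (jm : (j < m.+1)%N)).
  have [y _ <-] : range (phi (Ordinal (jm : (j < m.+1)%N))) (hw_act M (incl p) (vj M a j)).
    by rewrite rng; exists p.
  apply: lspan_map (br_G_span y) => [d s t|s [b ->]]; first by rewrite linearP.
  by apply: lspan_gen; exists (Ordinal (jm : (j < m.+1)%N)), b.
(* By nondegeneracy and spanning, a vector is determined by its pairings with the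
   [phi j (br_G b)]. *)
have ext x y :
    (forall j b, br_form M x (phi j (br_G b)) = br_form M y (phi j (br_G b))) ->
    x = y.
  move=> xy; apply/eqP; rewrite -subr_eq0; apply/eqP.
  apply: (shapovalov_nondegenerate sP) => z.
  elim: (span z) => [|d _ t [j [b ->]] _ IH]; rewrite (contravariantC fP).
    exact: contravariant0 fP _.
  rewrite (contravariant_lin fP) !(contravariantC fP _ (x - y)) IH addr0.
  by rewrite (contravariantB fP) xy subrr mulr0.
(* If the norm were 0, [v_j] would be orthogonal to its own summand as well as to the others, hence
   0, against injectivity of [phi j]. *)
have norm_neq0 (j : 'I_m.+1) : norm j != 0.
  apply/eqP => n0; have [phi_inj _ _ phi_v] := hphi j.
  have : phi j (hw_vec (N j)) = 0.
    apply: ext => j' b; rewrite (contravariant0 fP).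
    have [e|jj] := eqVneq j j'; last exact: ortho.
    by subst j'; rewrite phi_form n0 mul0r.
  rewrite -(linear0 (phi j)) => /phi_inj /eqP; rewrite (negPf (hw_vec_neq0 _)) //.
(* A nonzero vector cannot lie in two eigenspaces. *)
have phiB_inj (j j' : 'I_m.+1) b b' : phiB j b = phiB j' b' -> j = j'.
  move=> e; apply/deg_inj/eqP; rewrite -subr_eq0; apply/negPn/negP => n0.
  apply: (@br_G_eq0 _ _ M (phiB j b)); apply/(scalerI n0).
  rewrite scaler0 scalerBl -{1}phiG -phi_deg phiG e -phiG phi_deg phiG subrr //.
(* Both sides have the same pairings with all [phi j' (br_G b')]: the division by the norm cancels
   the factor from [phi_form]. *)
have phiF (j : 'I_m.+1) (b : br_B (N j)) :
    (norm j)^-1 *: phi j (br_F (N j) b) = br_F M (phiB j b).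
  apply: ext => j' b'; rewrite phiG br_dual (contravariantZ fP) -phiG.
  have [e|jj] := eqVneq j j'; last first.
    rewrite (ortho _ _ _ _ jj) mulr0; case: eqP => // /phiB_inj e.
    by rewrite e eqxx in jj.
  subst j'; rewrite phi_form br_dual mulKf ?norm_neq0 //.
  congr (_%:R); congr nat_of_bool; apply/eqP/eqP => [->//|e].
  have [phi_inj _ _ _] := hphi j.
  by apply/br_G_inj/phi_inj; rewrite !phiG e.
(* For an index [b] that is missed, [br_F M b] would be orthogonal to everything, yet it pairs to 1
   with [br_G b]. *)
have phiB_surj b : exists j b', b = phiB j b'.
  apply: contrapT => nb; have : br_F M b = 0.
    apply: ext => j b'; rewrite phiG br_dual (contravariant0 fP).
    by case: eqP => // e; case: nb; exists j, b'.
  move=> F0; have := br_dual b b; rewrite F0 (contravariant0 fP) eqxx.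
  by move/esym/eqP; rewrite (negPf (oner_neq0 _)).
split=> //.
- apply/seteqP; split=> [_ [b _ <-]|_ [j _ [b _ <-]]].
    by have [j [b' ->]] := phiB_surj b; exists j => //; exists b' => //; rewrite phiF.
  by exists (phiB j b) => //; rewrite phiF.
- move=> j j' _ _ [_ [[b _ <-] [b' _ e]]].
  by apply: (@phiB_inj _ _ b b'); apply: br_F_inj; rewrite -!phiF.
Qed.
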